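(* Let $\mathcal F$ be a saturated fusion system over a finite $p$-group $S$, and assume $A\le S$ is an abelian subgroup such that $C_S(A)=A$ and $A$ is not normal in $\mathcal F$. Set $T=\mathrm{Aut}_S(A)$. Then $\mathscr R_T(A)\ne\emptyset$, and hence $\mathscr R^+_T(A)\ne\emptyset$. More precisely: (a) In all cases, if $(t,U,A_* )\in\mathscr W_{\mathcal F}(A)$ is such that $U\cap A=A_*$, then $(c_t^A,\mathrm{Aut}_U(A),A_* )\in\widehat{\mathscr R}_T(A)$. (b) If $A$ is not weakly closed in $\mathcal F$, then there is a subgroup $U\in A^{\mathcal F}\smallsetminus\{A\}$ such that $(c_t^A,\mathrm{Aut}_U(A),A\cap U)\in\mathscr R_T(A)$ for each $t\in U\smallsetminus A$. (c) If $A$ is weakly closed in $\mathcal F$, then there is a subgroup $Z\le A$, fully centralized in $\mathcal F$, such that $A$ is not normal in $C_{\mathcal F}(Z)$, and such that for each $t\in\mathscr T_{C_{\mathcal F}(Z)}(A)$ there is $U\in\mathscr U_{C_{\mathcal F}(Z)}(A)$ such that $$U\cap A\le Z\qquad\text{and}\qquad (c_t^A,\mathrm{Aut}_U(A),U\cap A)\in\mathscr R_{C_T(Z)}(A)\subseteq\mathscr R_T(A).$$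
   Context: Fusion systems. For a prime $p$ and a finite $p$-group $S$, a fusion system $\mathcal{F}$ over $S$ is a category whose objects are the subgroups of $S$, whose morphisms are injective homomorphisms (with the usual composition), such that for all $P,Q\le S$ the set $\mathrm{Hom}_{\mathcal F}(P,Q)$ contains all maps $x\mapsto gxg^{-1}$ for $g\in S$ with $gPg^{-1}\le Q$, and such that every morphism is the composite of an $\mathcal F$-isomorphism followed by an inclusion. Subgroups isomorphic in $\mathcal F$ are called $\mathcal F$-conjugate; $P^{\mathcal F}$ is the $\mathcal F$-conjugacy class of $P\le S$, and for $x\in S$, $x^{\mathcal F}=\{\varphi(x)\mid\varphi\in\mathrm{Hom}_{\mathcal F}(\langle x\rangle,S)\}$. A subgroup $P\le S$ is fully normalized (fully centralized) if $|N_S(P)|\ge|N_S(Q)|$ (resp. $|C_S(P)|\ge|C_S(Q)|$) for every $Q\in P^{\mathcal F}$. $\mathcal F$ is saturated if (1) each fully normalized $P$ is fully centralized and $\mathrm{Aut}_S(P)\in\mathrm{Syl}_p(\mathrm{Aut}_{\mathcal F}(P))$; and (2) each $\varphi\in\mathrm{Iso}_{\mathcal F}(P,Q)$ with $Q$ fully centralized extends to a morphism in $\mathrm{Hom}_{\mathcal F}(N_\varphi,S)$, where $N_\varphi=\{g\in N_S(P)\mid \varphi c_g\varphi^{-1}\in\mathrm{Aut}_S(Q)\}$. A subgroup $P\le S$ is weakly closed in $\mathcal F$ if $P^{\mathcal F}=\{P\}$, and is normal in $\mathcal F$ if each morphism in $\mathrm{Hom}_{\mathcal F}(Q,R)$ extends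 to a morphism in $\mathrm{Hom}_{\mathcal F}(QP,RP)$ that sends $P$ to itself. For $Q\le S$, $C_{\mathcal F}(Q)$ is the fusion system over $C_S(Q)$ with $\mathrm{Hom}_{C_{\mathcal F}(Q)}(P,R)=\{\varphi|_P\mid \varphi\in\mathrm{Hom}_{\mathcal F}(PQ,RQ),\ \varphi(P)\le R,\ \varphi|_Q=\mathrm{Id}_Q\}$. Notation. For $g\in N_S(A)$, $c_g^A\in\mathrm{Aut}(A)$ is $x\mapsto gxg^{-1}$. For $U\le N_S(A)$, $\mathrm{Aut}_U(A)=\{c_u^A\mid u\in U\}$, and $\mathrm{Aut}_S(A)=\{c_g^A\mid g\in N_S(A)\}$. For $T\le\mathrm{Aut}(A)$, $C_T(Z)$ is the subgroup of elements of $T$ acting trivially on $Z$. For a group $G$, $G^\#=G\smallsetminus\{1\}$. For a fusion system $\mathcal F$ over $S$ and an abelian subgroup $A\le S$, set - $\mathscr U_{\mathcal F}(A)=\{1\ne U\le N_S(A)\mid U\nleq A,\ \mathrm{Hom}_{\mathcal F}(U,A)\ne\emptyset\}$; - $\mathscr T_{\mathcal F}(A)=\{t\in N_S(A)\smallsetminus A\mid t^{\mathcal F}\cap A\ne\emptyset\}$; - $\mathscr W_{\mathcal F}(A)$ = the set of triples $(t,U,A_* )$ with $t\in\mathscr T_{\mathcal F}(A)$, $U\in\mathscr U_{\mathcal F}(A)$, $A_*\le C_A(t)$, $A_*\in(U\cap A)^{\mathcal F}$, and $|UA/A|=|C_{A/A_*}(t)|$. For a finite abelian $p$-group $A$ and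 a $p$-subgroup $T\le\mathrm{Aut}(A)$: $\widehat{\mathscr R}^+_T(A)$ is the set of triples $(\tau,B,A_* )$ such that $\tau\in T^\#$, $B\le T$, $\langle\tau\rangle$ and $B$ are isomorphic to subgroups of $A$, $A_*\le C_A(\langle B,\tau\rangle)$, and $|B|\ge|C_{A/A_*}(\tau)|$. $\widehat{\mathscr R}_T(A)$ is the subset of those triples with $|B|=|C_{A/A_*}(\tau)|$. $\mathscr R_T(A)$ (resp. $\mathscr R^+_T(A)$) is the (unique) largest subset $\mathcal R$ of $\widehat{\mathscr R}_T(A)$ (resp. of $\widehat{\mathscr R}^+_T(A)$) satisfying: for each $(\tau,B,A_* )\in\mathcal R$ and each $\tau_1\in B^\#$, there is an element of $\mathcal R$ of the form $(\tau_1,B_1,A_{*1})$. *)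

(* Defs.v *)
From HB Require Import structures.
From mathcomp Require Import all_boot all_fingroup all_solvable.

Set Implicit Arguments.
Unset Strict Implicit.
Unset Printing Implicit Defensive.

Import GroupScope.

(* The finite p-group S is a subgroup of an ambient finite group gT.  A map   *)
(* with source P <= S is represented by any f : {ffun gT -> gT} having the    *)
(* right values on P; the values of f outside P are irrelevant (this is what  *)
(* fusion_ext below expresses).  F P Q is the set Hom_F(P, Q), which is empty *)
(* unless P and Q are subgroups of S.                                         *)
Definition homsets (gT : finGroupType) : Type :=
  {group gT} -> {group gT} -> {set {ffun gT -> gT}}.

Section Fusion.

Variable gT : finGroupType.
Implicit Types (S P Q R A U Z : {group gT}) (F : homsets gT).
Implicit Types f g phi psi : {ffun gT -> gT}.

Definition comp_ffun g f : {ffun gT -> gT} := [ffun x => g (f x)].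

Definition conj_ffun (g : gT) : {ffun gT -> gT} := [ffun x => g * x * g^-1].

Definition eq_on P f g : bool := [forall x in P, f x == g x].

Definition fiso F P Q : {set {ffun gT -> gT}} :=
  [set f in F P Q | [exists g in F Q P,
     [forall x in P, g (f x) == x] && [forall y in Q, f (g y) == y]]].

Record fusion_system S F : Prop := FusionSystem {
  fusion_obj : forall P Q f, f \in F P Q -> P \subset S /\ Q \subset S;
  fusion_ext : forall P Q f g, eq_on P f g -> f \in F P Q -> g \in F P Q;
  fusion_morph : forall P Q f, f \in F P Q ->
    [/\ {in P &, {morph f : x y / x * y}}, {in P &, injective f}
      & f @: P \subset Q];
  fusion_comp : forall P Q R f g,
    f \in F P Q -> g \in F Q R -> comp_ffun g f \in F P R;
  fusion_conj : forall P Q (g : gT), P \subset S -> Q \subset S -> g \in S ->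
    conj_ffun g @: P \subset Q -> conj_ffun g \in F P Q;
  fusion_factor : forall P Q f, f \in F P Q ->
    exists2 R : {group gT}, R \subset Q & f \in fiso F P R
}.

Definition fclass F P : {set {group gT}} :=
  [set Q | fiso F P Q != set0].

Definition fclass_elt S F (x : gT) : {set gT} :=
  [set phi x | phi : {ffun gT -> gT} in F <[x]>%G S].

Definition fully_normalized S F P : bool :=
  (P \subset S) && [forall Q in fclass F P, #|'N_S(P)| >= #|'N_S(Q)|].

Definition fully_centralized S F P : bool :=
  (P \subset S) && [forall Q in fclass F P, #|'C_S(P)| >= #|'C_S(Q)|].

(* conj_aut A g is x |-> g^-1 * x * g, hence the inverse in c_g^A.            *)
Definition caut A (g : gT) : {perm gT} := conj_aut A g^-1.

(* morphim only uses the elements of U in the domain 'N(A) of conj_aut A, so  *)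
(* autU U A is Aut_U(A) when U <= N_S(A), and autU S A is Aut_S(A).           *)
Definition autU U A : {group {perm gT}} := [group of conj_aut A @* U].

Definition autF F P : {set {perm gT}} :=
  [set s in Aut P | [ffun x => s x] \in F P P].

(* phi c_g phi^-1 = c_h on Q = phi(P), precomposed with phi.                  *)
Definition Nphi S P Q phi : {set gT} :=
  [set g in 'N_S(P) | [exists h in 'N_S(Q),
     [forall x in P, phi (g * x * g^-1) == h * phi x * h^-1]]].

(* Nphi is a subgroup whenever phi is an F-isomorphism from P to Q; << >>     *)
(* only supplies its {group gT} structure.                                    *)
Definition saturated (p : nat) S F : Prop :=
  (forall P, fully_normalized S F P ->
     fully_centralized S F P /\ p.-Sylow(autF F P) (autU S P)) /\
  (forall P Q phi, phi \in fiso F P Q -> fully_centralized S F Q ->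
     exists2 psi, psi \in F <<Nphi S P Q phi>>%G S & eq_on P psi phi).

Definition weakly_closed F P : Prop := fclass F P = [set P].

(* The case Q = R = S forces P to be normal in S, so that the joins Q <*> P   *)
(* and R <*> P are the products QP and RP.                                    *)
Definition fnormal F P : Prop :=
  forall Q R phi, phi \in F Q R ->
    exists psi, [/\ psi \in F (Q <*> P)%G (R <*> P)%G, eq_on Q psi phi
                  & psi @: P = P].

Definition fcent S F Q : homsets gT := fun P R =>
  [set f | [&& P \subset 'C_S(Q), R \subset 'C_S(Q)
    & [exists phi in F (P <*> Q)%G (R <*> Q)%G,
        [&& eq_on P f phi, phi @: P \subset R & [forall x in Q, phi x == x]]]]].

Definition scrU S F A : {set {group gT}} :=
  [set U : {group gT} | [&& U :!=: 1, U \subset 'N_S(A), ~~ (U \subset A)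
                          & F U A != set0]].

Definition scrT S F A : {set gT} :=
  [set t in 'N_S(A) :\: A | fclass_elt S F t :&: A != set0].

Definition scrW S F A : {set gT * {group gT} * {group gT}} :=
  [set w : gT * {group gT} * {group gT} | let: (t, U, As) := w in
    [&& t \in scrT S F A, U \in scrU S F A, As \subset 'C_A[t],
        As \in fclass F (U :&: A)%G
      & #|(U <*> A) / A| == #|'C_(A / As)[coset As t]|]].

End Fusion.

Section Rsets.

Variable gT : finGroupType.
Implicit Types (A As : {group gT}) (T B : {group {perm gT}}).
Implicit Type tau : {perm gT}.

Definition Rtriple : finType :=
  ({perm gT} * {group {perm gT}} * {group gT})%type.

Implicit Type Rs : {set Rtriple}.

Definition embeds_in (rT : finGroupType) (B : {group rT}) A : bool :=
  [exists C : {group gT}, (C \subset A) && (B \isog C)].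

Definition Rhat_plus T A : {set Rtriple} :=
  [set w : Rtriple | let: (tau, B, As) := w in
    [&& tau \in T^#, B \subset T, embeds_in <[tau]>%G A, embeds_in B A,
        As \subset 'C_(A | [Aut A])(B <*> <[tau]>)
      & #|B| >= #|'C_(A / As | [Aut A] / As)[tau]|]].

Definition Rhat T A : {set Rtriple} :=
  [set w in Rhat_plus T A | let: (tau, B, As) := w in
    #|B| == #|'C_(A / As | [Aut A] / As)[tau]|].

Definition Rclosed Rs : bool :=
  [forall w in Rs, forall tau1 in (w.1.2)^#, exists w1 in Rs, w1.1.1 == tau1].

Definition Rlargest (Rs0 : {set Rtriple}) : {set Rtriple} :=
  \bigcup_(Rs : {set Rtriple} | (Rs \subset Rs0) && Rclosed Rs) Rs.

Lemma Rlargest_sub Rs0 : Rlargest Rs0 \subset Rs0.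
Proof. by apply/bigcupsP=> Rs /andP[]. Qed.

Lemma Rlargest_closed Rs0 : Rclosed (Rlargest Rs0).
Proof.
apply/'forall_implyP=> w /bigcupP[Rs okRs wRs].
have [_ /'forall_implyP/(_ w wRs)/'forall_implyP cRs] := andP okRs.
apply/'forall_implyP=> tau1 /cRs/exists_inP[w1 w1Rs Dw1].
by apply/exists_inP; exists w1 => //; apply/bigcupP; exists Rs.
Qed.

Lemma Rlargest_max Rs0 Rs :
  Rs \subset Rs0 -> Rclosed Rs -> Rs \subset Rlargest Rs0.
Proof. by move=> sRs cRs; apply: bigcup_sup; rewrite sRs. Qed.

Definition scrR T A : {set Rtriple} := Rlargest (Rhat T A).

Definition scrR_plus T A : {set Rtriple} := Rlargest (Rhat_plus T A).

End Rsets.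

(* Main.v *)
(* If A is not weakly closed, an S-conjugation and, when A is normal in S, the
   extension property applied to a conjugate U of A that is not normal in S
   give U <> A in the class of A such that U and A normalise each other; then
   every t in U acts trivially on A / (A :&: U), which yields the triples in (b).
   If A is weakly closed but not normal, then it is not strongly closed. Take
   Z <= A fully centralized of maximal order such that A is not strongly closed
   in C_F(Z). For t outside A that C_F(Z) moves into A, let D be the preimage in
   A of C_{A/Z}(t). Saturation gives a morphism f of C_F(Z) defined on D<t> with
   f(t) in A, and U = f(D) satisfies U :&: A = Z by maximality of Z, whence
   |U / Z| = |C_{A/Z}(t)|. Choosing Z by strong closure rather than normality
   avoids having to know that C_F(Z) is saturated. *)

Require Import Defs.
From mathcomp Require Import all_boot all_fingroup all_solvable.

Set Implicit Arguments.
Unset Strict Implicit.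
Unset Printing Implicit Defensive.

Import GroupScope.

(** * Quotients of abelian groups embed as subgroups *)

Lemma isog_subgroup (aT rT : finGroupType) (G C : {group aT})
    (H : {group rT}) :
  G \isog H -> C \subset G -> exists2 D : {group rT}, D \subset H & C \isog D.
Proof.
case/isogP=> f injf <- sCG; exists (f @* C)%G; first exact: morphimS.
exact: sub_isog.
Qed.

(** Induction on the order of [G], with [y] in [G] of order the exponent. If [K] meets [<[y]>]
    trivially, the image of [y] splits off from [G / K] with complement [L / K], and induction
    applies to [L]. Otherwise [G / M], for [M] the intersection, embeds in [G], and induction
    applies to [G / M]. The result is needed because [Aut_U(A)] is a quotient of [U] and has to
    embed in [A]. *)
Lemma abelian_quotient_isog (gT : finGroupType) (G K : {group gT}) :
  abelian G -> K \subset G ->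
  exists2 H : {group gT}, H \subset G & G / K \isog H.
Proof.
have [n] := ubnP #|G|; elim: n gT G K => // n IHn gT G K /ltnSE leGn cGG sKG.
have nKs (H : {group gT}) : H \subset G -> H \subset 'N(K).
  by move=> sHG; rewrite cents_norm // (sub_abelian_cent2 cGG).
have [G1 | ntG] := eqVneq (G : {set gT}) 1.
  exists 1%G; first exact: sub1G.
  by rewrite G1 quotient1 trivial_isog.
have [y Gy expG] := exponent_witness (abelian_nil cGG).
have nty : y != 1.
  by apply: contraNneq ntG => y1; rewrite trivg_exponent expG y1 order1.
have sYG: <[y]> \subset G by rewrite cycle_subG.
have [tiKY | ntKY] := eqVneq (K :&: <[y]>) 1.
  have isoY: <[y]> \isog <[coset K y]>.
    by rewrite -quotient_cycle ?quotient_isog ?(subsetP (nKs G _)) ?nKs // setIC.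
  (* The order of the coset divides the exponent of [G / K], which divides that of [G]; the latter
     is [#[y]], and [#[y]] is preserved because [<[y]>] meets [K] trivially. *)
  have oy': #[coset K y] = exponent (G / K).
    apply/eqP; rewrite eqn_dvd dvdn_exponent ?mem_quotient //=.
    by rewrite [#[_]]orderE -(card_isog isoY) -orderE -expG exponent_quotient.
  have cGGK := quotient_abelian K cGG.
  have Gy' : coset K y \in G / K by rewrite mem_quotient.
  have /splitsP[L1 /complP[tiYL defGK]] := abelian_splits Gy' oy' cGGK.
  have [L [defL sKL sLG]] : exists L : {group gT},
      [/\ L1 = L / K :> {set _}, K \subset L & L \subset G].
    have sL1: L1 \subset G / K by rewrite -defGK mulG_subr.
    have nKG: K <| G by rewrite /normal sKG nKs.
    by case: (inv_quotientS nKG sL1) => L defL sKL sLG; exists L; split.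
  have sub_ltn: L \proper G.
    rewrite properEneq sLG andbT; apply: contraNneq nty => eqLG.
    rewrite eqLG in defL; apply/eqP/set1gP; rewrite -tiKY inE cycle_id andbT.
    rewrite coset_idr ?(subsetP (nKs G _)) //; apply/set1gP.
    by rewrite -tiYL inE cycle_id defL.
  have [||H1 sH1L isoH1] := IHn _ L K _ _ sKL.
  - by rewrite (leq_trans _ leGn) // proper_card.
  - exact: abelianS cGG.
  have tiYH1 : <[y]> :&: H1 = 1.
    apply/trivgP/subsetP=> x /setIP[Yx H1x]; rewrite -tiKY inE Yx andbT.
    have nKx: x \in 'N(K) by apply: subsetP Yx; apply: nKs.
    rewrite coset_idr //; apply/set1gP; rewrite -tiYL inE defL.
    rewrite mem_quotient ?(subsetP sH1L) // andbT -quotient_cycle ?mem_quotient //.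
    by rewrite (subsetP (nKs G _)).
  have sH1G := subset_trans sH1L sLG.
  exists (<[y]> <*> H1)%G; first by rewrite join_subG sYG.
  apply: (@isog_dprod _ _ <[coset K y]> L1 _ <[y]> H1 _); last by rewrite defL.
  - by rewrite dprodE // (sub_abelian_cent2 cGGK) ?cycle_subG // -defGK mulG_subr.
  - by rewrite dprodEY // (sub_abelian_cent2 cGG).
  - by rewrite isog_sym.
set M := (K :&: <[y]>)%G.
have sMY: M \subset <[y]> by apply: subsetIr.
have sMG := subset_trans sMY sYG.
have nMs (H : {group gT}) : H \subset G -> H \subset 'N(M).
  by move=> sHG; rewrite cents_norm // (sub_abelian_cent2 cGG).
have [|||H1 sH1 isoH1] := IHn _ (G / M)%G (K / M)%G.
- rewrite (leq_trans _ leGn) // ltn_quotient //.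
- exact: quotient_abelian.
- exact: quotientS.
have /splitsP[L /complP[tiYL defG]] := abelian_splits Gy (esym expG) cGG.
have sLG: L \subset G by rewrite -defG mulG_subr.
have dG : <[y]> \x L = G by rewrite dprodE // (sub_abelian_cent2 cGG).
(* The exponent [#|M|] makes [<[z]>] a cyclic group of the same order as [<[y]> / M]. *)
set z := y ^+ #|M|; have sZY: <[z]> \subset <[y]> by rewrite cycleX.
have isoGM : G / M \isog (<[z]> <*> L).
  have tiML : M :&: L = 1 by apply/trivgP; rewrite -tiYL setSI.
  apply: (@isog_dprod _ _ (<[y]> / M) (L / M) _ <[z]> L _).
  - have tiYLM : <[y]> / M :&: L / M = 1 by rewrite -quotientGI ?tiYL ?quotient1.
    rewrite dprodE ?tiYLM -?quotientMl ?defG ?nMs //.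
    by rewrite quotient_cents // (sub_abelian_cent2 cGG).
  - rewrite dprodEY //; first by rewrite (sub_abelian_cent2 cGG) // (subset_trans sZY).
    by apply/trivgP; rewrite -tiYL setSI.
  - rewrite isog_cyclic_card ?quotient_cyclic ?cycle_cyclic //=.
    rewrite card_quotient ?nMs // -divgS //= -!orderE.
    by rewrite orderXdiv // cardSg.
  - by rewrite isog_sym quotient_isog // nMs.
have [H sHZL isoH] := isog_subgroup isoGM sH1.
exists H.
  by rewrite (subset_trans sHZL) // join_subG sLG (subset_trans sZY).
apply: isog_trans isoH; apply: isog_trans isoH1.
rewrite isog_sym third_isog ?subsetIl //.
  by rewrite /normal sMG nMs.
by rewrite /normal sKG nKs.
Qed.

(** * The triples of the sets R_T(A) *)

Section Triples.

Variables (gT : finGroupType) (A : {group gT}).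
Hypothesis cAA : abelian A.
Implicit Types (U As : {group gT}) (T : {group {perm gT}}).

Lemma embeds_in_isog (rT : finGroupType) (B : {group rT}) (C : {group gT}) :
  C \subset A -> B \isog C -> embeds_in B A.
Proof. by move=> sCA isoBC; apply/exists_inP; exists C. Qed.

(** The image is a quotient of [U], which is abelian because it embeds in [A]; such a quotient
    embeds back into [U]. *)
Lemma embeds_in_morphim (aT rT : finGroupType) (D U : {group aT})
    (f : {morphism D >-> rT}) :
  U \subset D -> embeds_in U A -> embeds_in (f @* U)%G A.
Proof.
move=> sUD /exists_inP[C sCA isoUC].
have cUU : abelian U by rewrite (isog_abelian isoUC) (abelianS sCA).
have [H sHU isoH] := abelian_quotient_isog cUU (subsetIl U ('ker f)).
have [E sEC isoHE] := isog_subgroup isoUC sHU.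
apply: embeds_in_isog (subset_trans sEC sCA) _; apply: isog_trans isoHE.
by rewrite isog_sym in isoH; rewrite isog_sym (isog_trans isoH) ?first_isog_loc.
Qed.

Lemma caut_Aut (t : gT) : caut A t \in Aut A.
Proof. by rewrite /caut Aut_aut. Qed.

Lemma autUP U s : U \subset 'N(A) ->
  s \in autU U A -> exists2 u, u \in U & s = caut A u.
Proof.
move=> nAU /morphimP[u _ Uu ->]; exists u^-1; rewrite ?groupV //.
by rewrite /caut invgK.
Qed.

Lemma cautE t x : t \in 'N(A) -> x \in A -> caut A t x = x ^ t^-1.
Proof. by move=> nAt Ax; rewrite norm_conj_autE ?groupV. Qed.

Lemma caut_eq1 t : t \in 'N(A) -> (caut A t == 1) = (t \in 'C(A)).
Proof.
move=> nAt; have nAt1 : t^-1 \in 'N(A) by rewrite groupV.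
rewrite -(groupV 'C(A)) /= -ker_conj_aut; apply/eqP/idP => [|/mker //].
by move=> t1; apply/kerP.
Qed.

Lemma card_autU U : U \subset 'N(A) -> #|autU U A| = #|U : 'C_U(A)|.
Proof. by move=> nAU; rewrite card_morphim ker_conj_aut (setIidPr nAU) indexgI. Qed.

Lemma caut_astab As t : t \in 'N(A) -> As \subset 'C_A[t] ->
  caut A t \in 'C(As | [Aut A]).
Proof.
move=> nAt; rewrite subsetI => /andP[/subsetP sAsA /subsetP cAst].
rewrite in_setI caut_Aut inE /=; apply/subsetP=> x Asx.
rewrite inE /= /autact /= apermE cautE ?sAsA // conjgE invgK mulgA.
by rewrite -(cent1P (cAst x Asx)) mulgK.
Qed.

(** Reconciles the fixed points used for the triples of automorphisms with the centralizer used in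
    [scrW]: on [A / As] the automorphism acts as conjugation by the inverse of the coset of [t]. *)
Lemma gacent_caut As t : t \in 'N(A) -> As \subset 'C_A[t] ->
  'C_(A / As | [Aut A] / As)[caut A t] = 'C_(A / As)[coset As t].
Proof.
move=> nAt; rewrite subsetI => /andP[sAsA cAst].
have nAsA : A \subset 'N(As) by rewrite cents_norm // (sub_abelian_cent2 cAA).
have nAst : t \in 'N(As).
  by rewrite (subsetP (cent_sub As)) // -sub_cent1.
(* Fixed points of a group action only take account of acting elements in its domain, so this
   membership must come first. *)
have Da : caut A t \in qact_dom [Aut A] As.
  rewrite qact_domE // (subsetP (astab_sub _ _)) // caut_astab //.
  by rewrite subsetI sAsA.
rewrite gacent1E //; apply/setP=> y; rewrite !in_setI.
have [/morphimP[x nAsx Ax ->] /= | //] := boolP (y \in A / As).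
rewrite (sameP afix1P eqP) (sameP cent1P eqP).
rewrite qactE // [X in coset As X]/= /autact /= apermE cautE //.
rewrite morphJ ?groupV // morphV //=.
by rewrite conjgE invgK mulgA -(inj_eq (mulIg (coset As t))) mulgKV eq_sym.
Qed.

Lemma mem_Rhat T t U As : t \in 'N(A) -> U \subset 'N(A) ->
  As \subset 'C_A[t] -> As \subset 'C(U) -> caut A t \in T^# ->
  autU U A \subset T -> embeds_in <[t]>%G A -> embeds_in U A ->
  #|autU U A| = #|'C_(A / As)[coset As t]| ->
  (caut A t, autU U A, As) \in Rhat T A.
Proof.
move=> nAt nAU cAst cAsU Tt sUT emb_t emb_U cardU.
have [sAsA cAst1] : As \subset A /\ As \subset 'C[t].
  by apply/andP; rewrite -subsetI.
rewrite inE [_ \in Rhat_plus _ _]inE gacent_caut // cardU eqxx leqnn Tt sUT !andbT.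
have emb_U' : embeds_in (autU U A) A by rewrite embeds_in_morphim.
have nAct : <[t]> \subset 'N(A) by rewrite cycle_subG.
have emb_t' : embeds_in <[caut A t]>%G A.
  have -> : <[caut A t]>%G = autU <[t]> A.
    apply: val_inj; rewrite /= morphim_cycle // /caut morphV //.
    by rewrite cycleV.
  exact: embeds_in_morphim.
rewrite emb_U' emb_t' /=.
have sBAut : autU U A <*> <[caut A t]> \subset Aut A.
  by rewrite join_subG Aut_conj_aut cycle_subG caut_Aut.
rewrite gacentE // !subsetI sAsA /= -astabCin // join_subG cycle_subG.
rewrite caut_astab // andbT; apply/subsetP=> _ /(autUP nAU)[u Uu ->].
rewrite caut_astab ?(subsetP nAU) // subsetI sAsA sub_cent1.
by apply: subsetP u Uu; rewrite centsC.
Qed.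

(** The triples of [Rhat T A] whose middle term is induced by some [V] with [V :\: 'C(A)] inside [E]
    form a closed set: a nontrivial element of [Aut_V(A)] is induced by some [u] in [E], and the
    hypothesis supplies a triple starting with it. Closed subsets of [Rhat T A] lie in
    [scrR T A]. *)
Lemma mem_scrR_family T (E : {set gT}) :
  (forall t, t \in E -> exists U As, [/\ U \subset 'N(A), U :\: 'C(A) \subset E
     & (caut A t, autU U A, As) \in Rhat T A]) ->
  forall t U As, U \subset 'N(A) -> U :\: 'C(A) \subset E ->
    (caut A t, autU U A, As) \in Rhat T A ->
  (caut A t, autU U A, As) \in scrR T A.
Proof.
move=> E_R t U As nAU sUE Rw.
pose Rs := [set w in Rhat T A | [exists V : {group gT},
  [&& V \subset 'N(A), V :\: 'C(A) \subset E & w.1.2 == autU V A]]].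
suff: Rs \subset scrR T A.
  move/subsetP; apply; rewrite inE Rw /=.
  by apply/existsP; exists U; rewrite nAU sUE eqxx.
apply: Rlargest_max; first by apply/subsetP=> w /setIdP[].
apply/'forall_implyP=> w /setIdP[_ /existsP[V /and3P[nAV sVE /eqP->]]].
apply/'forall_implyP=> tau /setD1P[nt /(autUP nAV)[u Vu Dtau]].
have nAu := subsetP nAV u Vu.
have Eu : u \in E.
  by apply: (subsetP sVE); rewrite inE Vu -caut_eq1 // -Dtau nt.
have [U1 [As1 [nAU1 sU1E Rw1]]] := E_R u Eu.
apply/exists_inP; exists (caut A u, autU U1 A, As1); last by rewrite Dtau.
by rewrite inE Rw1; apply/existsP; exists U1; rewrite nAU1 sU1E eqxx.
Qed.

Lemma scrR_sub T1 T2 : T1 \subset T2 -> scrR T1 A \subset scrR T2 A.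
Proof.
move=> sT12; apply: Rlargest_max (Rlargest_closed _).
apply: subset_trans (Rlargest_sub _) _; apply/subsetP=> [[[tau B] As]].
rewrite !in_set => /andP[/and5P[/andP[nt T1tau] sBT1 -> -> ->] ->].
by rewrite nt (subsetP sT12) // (subset_trans sBT1).
Qed.

Lemma scrR_sub_plus T : scrR T A \subset scrR_plus T A.
Proof.
apply: Rlargest_max (Rlargest_closed _).
by apply: subset_trans (Rlargest_sub _) _; apply/subsetP=> w /setIdP[].
Qed.

End Triples.

(** * Fusion systems *)

Section Fusion.

Variables (gT : finGroupType) (S : {group gT}) (F : homsets gT).
Hypothesis fusF : fusion_system S F.
Implicit Types (P Q R : {group gT}) (f g : {ffun gT -> gT}).

Lemma eq_onP P f g : reflect {in P, f =1 g} (eq_on P f g).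
Proof. by apply: (iffP forall_inP) => E x /E/eqP. Qed.

Lemma fus_src P Q f : f \in F P Q -> P \subset S.
Proof. by case/(fusion_obj fusF). Qed.

Lemma fus_tgt P Q f : f \in F P Q -> Q \subset S.
Proof. by case/(fusion_obj fusF). Qed.

Lemma fusM P Q f : f \in F P Q -> {in P &, {morph f : x y / x * y}}.
Proof. by case/(fusion_morph fusF). Qed.

Lemma fus_inj P Q f : f \in F P Q -> {in P &, injective f}.
Proof. by case/(fusion_morph fusF). Qed.

Lemma fus_im P Q f : f \in F P Q -> f @: P \subset Q.
Proof. by case/(fusion_morph fusF). Qed.

Lemma mem_fus P Q f x : f \in F P Q -> x \in P -> f x \in Q.
Proof. by move=> Ff Px; apply: (subsetP (fus_im Ff)); apply: imset_f. Qed.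

Lemma fus1 P Q f : f \in F P Q -> f 1 = 1.
Proof.
move=> Ff; apply: (mulgI (f 1)).
by rewrite -(fusM Ff) ?group1 // !mulg1.
Qed.

Lemma fusV P Q f : f \in F P Q -> {in P, {morph f : x / x^-1}}.
Proof.
move=> Ff x Px /=; apply: (mulgI (f x)).
by rewrite -(fusM Ff) ?groupV // !mulgV (fus1 Ff).
Qed.

Lemma fus_conj P Q f : f \in F P Q -> {in P &, {morph f : x y / x ^ y}}.
Proof.
move=> Ff x y Px Py.
by rewrite !conjgE !(fusM Ff) ?(fusV Ff) ?groupM ?groupV.
Qed.

Lemma fus_eq P Q f g : {in P, f =1 g} -> f \in F P Q -> g \in F P Q.
Proof. by move=> E; apply: (fusion_ext fusF); apply/eq_onP. Qed.

Lemma fus_incl P Q : P \subset Q -> Q \subset S -> [ffun x => x] \in F P Q.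
Proof.
move=> sPQ sQS; apply: fus_eq (_ : conj_ffun 1 \in _).
  by move=> x _; rewrite !ffunE mul1g invg1 mulg1.
apply: (fusion_conj fusF); rewrite ?group1 ?(subset_trans sPQ) //.
apply/subsetP=> _ /imsetP[x Px ->]; rewrite ffunE mul1g invg1 mulg1.
exact: subsetP Px.
Qed.

Lemma fus_comp P Q R f g : f \in F P Q -> g \in F Q R ->
  [ffun x => g (f x)] \in F P R.
Proof. exact: (fusion_comp fusF). Qed.

Lemma fus_res P P1 Q f : f \in F P Q -> P1 \subset P -> f \in F P1 Q.
Proof.
move=> Ff sP1; have Fi := fus_incl sP1 (fus_src Ff).
by apply: fus_eq (fus_comp Fi Ff) => x _; rewrite !ffunE.
Qed.

Lemma fus_widen P Q Q1 f :
  f \in F P Q -> Q \subset Q1 -> Q1 \subset S -> f \in F P Q1.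
Proof.
move=> Ff sQ sQ1; have Fi := fus_incl sQ sQ1.
by apply: fus_eq (fus_comp Ff Fi) => x _; rewrite !ffunE.
Qed.

Lemma fisoP P Q f : reflect (exists g, [/\ f \in F P Q, g \in F Q P,
    {in P, cancel f g} & {in Q, cancel g f}]) (f \in fiso F P Q).
Proof.
rewrite inE; apply: (iffP andP) => [[Ff /exists_inP[g Fg]] | [g [Ff Fg fK gK]]].
  case/andP=> /forall_inP fK /forall_inP gK.
  by exists g; split=> // x ?; apply/eqP; auto.
split=> //; apply/exists_inP; exists g => //.
by apply/andP; split; apply/forall_inP=> x ?; apply/eqP; auto.
Qed.

Lemma fiso_hom P Q f : f \in fiso F P Q -> f \in F P Q.
Proof. by case/setIdP. Qed.

Lemma fiso_im P Q f : f \in fiso F P Q -> f @: P = Q.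
Proof.
case/fisoP=> g [Ff Fg fK gK]; apply/eqP; rewrite eqEsubset (fus_im Ff) /=.
by apply/subsetP=> y Qy; rewrite -(gK y Qy) imset_f ?(mem_fus Fg).
Qed.

Lemma fus_fiso P Q f : f \in F P Q -> exists2 R, f \in fiso F P R & f @: P = R.
Proof.
by case/(fusion_factor fusF)=> R _ fR; exists R; rewrite ?(fiso_im fR).
Qed.

Lemma im_fiso P Q R f : f \in F P Q -> f @: P = R -> f \in fiso F P R.
Proof.
by case/fus_fiso=> R1 fR1 -> /val_inj <-.
Qed.

Lemma fus_corestrict P Q Q1 f :
  f \in F P Q -> f @: P \subset Q1 -> Q1 \subset S -> f \in F P Q1.
Proof.
move=> Ff; have [R fR ->] := fus_fiso Ff.
by apply: fus_widen; apply: fiso_hom.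
Qed.

Lemma fclassP P Q :
  reflect (exists2 f, f \in F P Q & f @: P = Q) (Q \in fclass F P).
Proof.
rewrite inE; apply: (iffP (set0Pn _)) => [[f fQ] | [f Ff fP]].
  by exists f; [apply: fiso_hom | apply: fiso_im].
by exists f; apply: im_fiso Ff fP.
Qed.

Lemma fiso_inv P Q f : f \in fiso F P Q ->
  exists g, [/\ g \in fiso F Q P, {in P, cancel f g} & {in Q, cancel g f}].
Proof.
case/fisoP=> g [Ff Fg fK gK]; exists g; split=> //.
by apply/fisoP; exists f.
Qed.

Lemma fiso_comp P Q R f g : f \in fiso F P Q -> g \in fiso F Q R ->
  [ffun x => g (f x)] \in fiso F P R.
Proof.
move=> fQ gR; apply: im_fiso (fus_comp (fiso_hom fQ) (fiso_hom gR)) _.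
rewrite -(fiso_im gR) -(fiso_im fQ) -imset_comp.
by apply: eq_imset => x; rewrite ffunE.
Qed.

Lemma fclass_sub P Q : Q \in fclass F P -> P \subset S /\ Q \subset S.
Proof. by case/fclassP=> f /(fusion_obj fusF). Qed.

Lemma fclass_refl P : P \subset S -> P \in fclass F P.
Proof.
move=> sPS; apply/fclassP; exists [ffun x => x]; first exact: fus_incl.
rewrite -[RHS]imset_id; apply: eq_imset => x; exact: ffunE.
Qed.

Lemma fclass_sym P Q : Q \in fclass F P -> P \in fclass F Q.
Proof.
rewrite !inE => /set0Pn[f /fiso_inv[g [gP _ _]]].
by apply/set0Pn; exists g.
Qed.

Lemma fclass_trans P Q R :
  Q \in fclass F P -> R \in fclass F Q -> R \in fclass F P.
Proof.
rewrite !inE => /set0Pn[f fQ] /set0Pn[g gR]; apply/set0Pn.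
by exists [ffun x => g (f x)]; apply: fiso_comp gR.
Qed.

Lemma fus_isog P Q f : f \in F P Q -> f @: P = Q -> P \isog Q.
Proof.
move=> Ff fP; pose m := Morphism (fusM Ff).
apply/isogP; exists m; first by apply/injmP/(fus_inj Ff).
by rewrite morphimEdom.
Qed.

Lemma fclass_isog P Q : Q \in fclass F P -> P \isog Q.
Proof. by case/fclassP=> f; apply: fus_isog. Qed.

Lemma fclass_card P Q : Q \in fclass F P -> #|Q| = #|P|.
Proof. by move/fclass_isog/card_isog. Qed.

Lemma fclass_fus P Q f : f \in F P Q ->
  exists2 R, R \in fclass F P & f @: P = R.
Proof.
by case/fus_fiso=> R fR fP; exists R => //; rewrite inE; apply/set0Pn; exists f.
Qed.

Lemma ex_fully_normalized P : P \subset S ->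
  exists2 Q, Q \in fclass F P & fully_normalized S F Q.
Proof.
move=> sPS.
case: (arg_maxnP (fun Q : {group gT} => #|'N_S(Q)|) (fclass_refl sPS)).
move=> Q PQ maxQ; exists Q => //.
apply/andP; split; first by case: (fclass_sub PQ).
by apply/forall_inP=> R /(fclass_trans PQ)/maxQ.
Qed.

Lemma ex_fully_centralized P : P \subset S ->
  exists2 Q, Q \in fclass F P & fully_centralized S F Q.
Proof.
move=> sPS.
case: (arg_maxnP (fun Q : {group gT} => #|'C_S(Q)|) (fclass_refl sPS)).
move=> Q PQ maxQ; exists Q => //.
apply/andP; split; first by case: (fclass_sub PQ).
by apply/forall_inP=> R /(fclass_trans PQ)/maxQ.
Qed.

Lemma normal_fully_normalized P : P <| S -> fully_normalized S F P.
Proof.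
case/andP=> sPS nPS; rewrite /fully_normalized sPS /=.
by apply/forall_inP=> Q _; rewrite (setIidPl nPS) subset_leq_card ?subsetIl.
Qed.

Lemma autFP P s : reflect (s \in Aut P /\ [ffun x => s x] \in F P P)
  (s \in autF F P).
Proof. exact: setIdP. Qed.

Lemma autF_group P : P \subset S -> group_set (autF F P).
Proof.
move=> sPS; apply/group_setP; split=> [|s t /autFP[As Fs] /autFP[At Ft]].
  apply/autFP; split; first exact: group1.
  by apply: fus_eq (fus_incl (subxx P) sPS) => x _; rewrite !ffunE perm1.
apply/autFP; split; first exact: groupM.
by apply: fus_eq (fus_comp Fs Ft) => x _; rewrite !ffunE permM.
Qed.

Lemma fiso_autF P f : f \in fiso F P P ->
  exists2 s, s \in autF F P & {in P, s =1 f}.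
Proof.
move=> fP; have Ff := fiso_hom fP; pose m := Morphism (fusM Ff).
have injm : 'injm m by apply/injmP/(fus_inj Ff).
have im_m : m @* P = P by rewrite morphimEdom; apply: fiso_im.
exists (aut injm im_m); last exact: autE.
apply/autFP; split; first exact: Aut_aut.
by apply: fus_eq (fiso_hom fP) => x Px; rewrite ffunE autE.
Qed.

Lemma autF_fiso P s : s \in autF F P -> [ffun x => s x] \in fiso F P P.
Proof.
case/autFP=> As Fs; apply: im_fiso Fs _.
by rewrite -[RHS](im_autm As) morphimEdom; apply: eq_imset => x; rewrite ffunE.
Qed.

Lemma fus_conjg P Q (g : gT) : P \subset S -> Q \subset S -> g \in S ->
  P :^ g \subset Q -> [ffun x => x ^ g] \in F P Q.
Proof.
move=> sPS sQS Sg sPgQ; have E x : conj_ffun g^-1 x = x ^ g.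
  by rewrite ffunE conjgE invgK mulgA.
apply: (fus_eq (f := conj_ffun g^-1)) => [x _|]; first by rewrite E ffunE.
apply: (fusion_conj fusF); rewrite ?groupV //.
by apply: subset_trans sPgQ; apply/subsetP=> _ /imsetP[x Px ->]; rewrite E memJ_conjg.
Qed.

(** * Weakly closed and strongly closed abelian subgroups *)

Variable A : {group gT}.
Hypotheses (sAS : A \subset S) (cAA : abelian A).

Section WeaklyClosed.

Hypothesis wcA : weakly_closed F A.

Lemma weakly_closed_im P f : f \in F P S -> A \subset P -> f @: A = A.
Proof.
move=> Ff sAP; have [R] := fclass_fus (fus_res Ff sAP).
by rewrite wcA inE => /eqP->.
Qed.

Lemma weakly_closed_normal : A <| S.
Proof.
rewrite /normal sAS; apply/subsetP=> g Sg; rewrite inE.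
have sAgS : A :^ g \subset S by rewrite conj_subG.
have /weakly_closed_im/(_ (subxx A)) E := fus_conjg sAS (subxx S) Sg sAgS.
apply/subsetP=> _ /imsetP[x Ax ->]; rewrite -E.
by apply/imsetP; exists x; rewrite ?ffunE.
Qed.

Lemma weakly_closed_im_join P Q f :
  f \in F (P <*> A)%G S -> f @: P = Q -> f @: (P <*> A) = Q <*> A.
Proof.
move=> Ff fP; pose m := Morphism (fusM Ff).
have mE (B : {set gT}) : B \subset P <*> A -> f @: B = m @* B.
  by move=> sB; rewrite morphimEsub.
rewrite mE // morphimY ?joing_subl ?joing_subr // -!mE ?joing_subl ?joing_subr //.
by rewrite fP (weakly_closed_im Ff) ?joing_subr.
Qed.

Hypothesis scA : scrT S F A = set0.

(** Weak closure makes [A] normal in [S], so an element outside [A] with an image in [A] would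
    belong to [scrT S F A]. The other direction applies this to the inverse of [f]. *)
Lemma strongly_closed P f x : f \in F P S -> x \in P -> (f x \in A) = (x \in A).
Proof.
have sub Q (h : {ffun gT -> gT}) y :
    h \in F Q S -> y \in Q -> h y \in A -> y \in A.
  move=> Fh Qy Ahy; apply: contraFT (in_set0 y) => Ay'; rewrite -scA !inE Ay'.
  have Sy := subsetP (fus_src Fh) y Qy; rewrite Sy /=.
  have /andP[_ nAS] := weakly_closed_normal.
  have := subsetP nAS y Sy; rewrite inE => -> /=.
  apply/set0Pn; exists (h y); rewrite inE Ahy andbT; apply/imsetP.
  by exists h => //; apply: fus_res Fh _; rewrite cycle_subG.
move=> Ff Px; apply/idP/idP; first exact: sub Ff Px.
have [R fR fP] := fus_fiso Ff; have [g [gP fK _]] := fiso_inv fR.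
have Fg := fiso_hom gP; move=> Ax; apply: (sub R g) => //.
- exact: fus_widen Fg (fus_src Ff) (subxx S).
- by rewrite -fP imset_f.
by rewrite fK.
Qed.

End WeaklyClosed.

(** * Extension of morphisms under saturation *)

Variable p : nat.
Hypothesis pS : p.-group S.
Hypothesis satF : saturated p S F.

Lemma mem_Nphi P Q f (g k : gT) : g \in 'N_S(P) -> k \in 'N_S(Q) ->
  {in P, forall x, f (x ^ g^-1) = f x ^ k} -> g \in Nphi S P Q f.
Proof.
move=> Ng Nk E; rewrite inE Ng /=.
(* The inverse passes from the convention [x ^ k = k^-1 * x * k] to the left conjugation used in
   [Nphi]. *)
apply/exists_inP; exists k^-1; first by rewrite groupV.
apply/forall_inP=> x Px; apply/eqP; rewrite invgK.
by have := E x Px; rewrite !conjgE !invgK !mulgA.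
Qed.

(** Elements of [C_S(P)] induce the identity on [P], so they lie in [Nphi] with witness 1. *)
Lemma fully_centralized_ext P Q f : abelian P -> fully_centralized S F Q ->
  f \in fiso F P Q -> exists2 g, g \in F 'C_S(P)%G S & {in P, g =1 f}.
Proof.
move=> cPP fcQ fQ; have [_ /(_ P Q f fQ fcQ)[g Fg /eq_onP gE]] := satF.
exists g => //; apply: fus_res Fg _; apply: sub_gen.
apply/subsetP=> x /setIP[Sx cPx].
apply: (@mem_Nphi _ _ _ x 1) => [||y Py]; rewrite ?group1 //.
  by rewrite inE Sx (subsetP (cent_sub P)).
by rewrite conjg1 conjgE invgK mulgA (centP cPx) // mulgK.
Qed.

(** An isomorphism [f] from [P] to [Q] carries [Aut_S(P)] to a p-subgroup [X] of [Aut_F(Q)]. By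
    Sylow some [b] in [Aut_F(Q)] conjugates [X] into [Aut_S(Q)]; after correcting [f] by [b], all of
    [N_S(P)] lies in [Nphi]. *)
Lemma fully_normalized_ext P Q : fully_normalized S F Q -> Q \in fclass F P ->
  exists2 g, g \in F 'N_S(P)%G S & g @: P = Q.
Proof.
move=> fnQ PQ; have [sPS sQS] := fclass_sub PQ.
have [satF1 satF2] := satF; have [fcQ sylQ] := satF1 Q fnQ.
have [f fQ] : exists f, f \in fiso F P Q by apply/set0Pn; rewrite inE in PQ.
have Ff := fiso_hom fQ; have [f1 [f1P fK f1K]] := fiso_inv fQ.
have Ff1 := fiso_hom f1P.
pose G := group (autF_group sQS).
pose X := [set s in G | [exists g in 'N_S(P),
             [forall x in P, s (f x) == f (x ^ g)]]].
have XP s : reflect (s \in G /\ exists2 g, g \in 'N_S(P)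
    & {in P, forall x, s (f x) = f (x ^ g)}) (s \in X).
  apply: (iffP setIdP) => [] [Gs].
    case/exists_inP=> g Ng /forall_inP E; split=> //; exists g => // x Px.
    exact/eqP/E.
  case=> g Ng E; split=> //; apply/exists_inP; exists g => //.
  by apply/forall_inP=> x /E->.
have nPJ (g : gT) x : g \in 'N_S(P) -> x \in P -> x ^ g \in P.
  by case/setIP=> _ nPg Px; rewrite memJ_norm.
have gX : group_set X.
  apply/group_setP; split=> [|s t].
    apply/XP; split; first exact: group1.
    by exists 1 => [|x _]; rewrite ?group1 // perm1 conjg1.
  case/XP=> Gs [g Ng Es] /XP[Gt [h Nh Et]].
  apply/XP; split; first exact: groupM.
  exists (g * h) => [|x Px]; first exact: groupM.
  by rewrite permM Es // Et ?nPJ // conjgM.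
have pX : p.-group (group gX).
  apply/pgroupP=> q pr_q /(Cauchy pr_q)[s /XP[Gs [g Ng Es]] ordS].
  have Eexp (n : nat) : {in P, forall x, (s ^+ n) (f x) = f (x ^ (g ^+ n))}.
    elim: n => [|n IHn] x Px; first by rewrite perm1 conjg1.
    by rewrite expgSr permM IHn // Es ?nPJ ?groupX // expgSr conjgM.
  (* Powers of [s] are induced by the same powers of [g], so the prime order of [s] divides the
     order of the p-element [g]. *)
  have: s ^+ #[g] = 1.
    have AsQ : s \in Aut Q by case/autFP: Gs.
    apply: (eq_Aut (groupX _ AsQ) (group1 _)) => y Qy.
    by rewrite -(f1K y Qy) Eexp ?(mem_fus Ff1) // expg_order conjg1 perm1.
  move/eqP; rewrite -order_dvdn ordS => q_g.
  have pg : p.-elt g by apply: mem_p_elt pS _; case/setIP: Ng.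
  exact: (pnatP _ (order_gt0 g) pg).
have sXG : group gX \subset G by apply/subsetP=> s /XP[].
have [b Gb sXb] := Sylow_Jsub (sylQ : p.-Sylow(G) _) sXG pX.
have chiQ := fiso_comp fQ (autF_fiso Gb); set chi := [ffun x => _] in chiQ.
have chiE x : chi x = b (f x) by rewrite !ffunE.
have [psi Fpsi /eq_onP psiE] := satF2 P Q chi chiQ fcQ.
exists psi; last by rewrite -(fiso_im chiQ); apply: eq_in_imset.
apply: fus_res Fpsi _; apply: sub_gen; apply/subsetP=> g Ng.
have Ng1 : g^-1 \in 'N_S(P) by rewrite groupV.
have [Sg1 nPg1] := setIP Ng1.
have cP : [ffun x => x ^ g^-1] \in fiso F P P.
  have sPg1 : P :^ g^-1 \subset P by rewrite (normP nPg1).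
  apply: im_fiso (fus_conjg sPS sPS Sg1 sPg1) _.
  by rewrite -[RHS](normP nPg1); apply: eq_imset => x; rewrite ffunE.
have [s Gs sE] := fiso_autF (fiso_comp f1P (fiso_comp cP fQ)).
have Xs : s \in X.
  apply/XP; split=> //; exists g^-1 => // x Px.
  by rewrite sE ?(mem_fus Ff) // !ffunE fK.
(* Since [chi] is [f] followed by [b], the conjugate [s ^ b] is what conjugation by [g^-1] becomes
   on [Q] under [chi]; thus [k] is the witness for [g]. *)
have /morphimP[k nQk Sk sbE] : s ^ b \in autU S Q.
  by apply: (subsetP sXb); rewrite memJ_conjg.
apply: (@mem_Nphi _ _ _ g k) => //; first by rewrite inE Sk.
move=> x Px; have Qx : chi x \in Q by rewrite (mem_fus (fiso_hom chiQ)).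
rewrite -(norm_conj_autE nQk Qx) -sbE [in RHS]chiE permJ.
by rewrite sE ?(mem_fus Ff) // !ffunE fK.
Qed.

(** * Normality of strongly closed abelian subgroups *)

Section StronglyClosed.

Hypotheses (wcA : weakly_closed F A) (scA : scrT S F A = set0).

(* The automorphisms in K centralise both Q :&: A and Q / (Q :&: A), so that K
   is a p-group; it is normal in Aut_F(Q) because A is strongly closed, hence
   lies in the Sylow subgroup Aut_S(Q). *)
Lemma norm_sub_Nphi Q f :
  fully_normalized S F Q -> f \in fiso F Q Q -> 'N_A(Q) \subset Nphi S Q Q f.
Proof.
move=> fnQ fQ; have [_ sylQ] := satF.1 Q fnQ.
have sQS := fus_src (fiso_hom fQ); have /andP[_ nAS] := weakly_closed_normal wcA.
have scQ P Q1 (h : {ffun gT -> gT}) x :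
    h \in F P Q1 -> x \in P -> (h x \in A) = (x \in A).
  move=> Fh; apply: (strongly_closed wcA scA).
  exact: fus_widen Fh (fus_tgt Fh) (subxx S).
pose G := group (autF_group sQS).
have GQ s x : s \in G -> x \in Q -> s x \in Q.
  by move=> /autF_fiso/fiso_hom/mem_fus/[apply]; rewrite ffunE.
have GA s x : s \in G -> x \in Q -> (s x \in A) = (x \in A).
  by move=> /autF_fiso/fiso_hom/scQ/[apply]; rewrite ffunE.
have GM s : s \in G -> {in Q &, {morph s : x y / x * y}}.
  by move=> /autF_fiso/fiso_hom/fusM E x y Qx Qy; have := E x y Qx Qy; rewrite !ffunE.
have GV s : s \in G -> {in Q, {morph s : x / x^-1}}.
  by move=> /autF_fiso/fiso_hom/fusV E x Qx; have := E x Qx; rewrite !ffunE.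
pose K := [set s in G | [forall x in Q, x^-1 * s x \in A]
                         && [forall x in Q :&: A, s x == x]].
have KP s : reflect [/\ s \in G, {in Q, forall x, x^-1 * s x \in A}
    & {in Q, forall x, x \in A -> s x = x}] (s \in K).
  apply: (iffP setIdP) => [[Gs /andP[/forall_inP s1 /forall_inP s2]] | [Gs s1 s2]].
    by split=> // x Qx Ax; apply/eqP/s2; rewrite inE Qx.
  split=> //; apply/andP; split; apply/forall_inP=> //.
  by move=> x /setIP[Qx Ax]; rewrite s2.
have gK : group_set K.
  apply/group_setP; split=> [|s t /KP[Gs s1 s2] /KP[Gt t1 t2]].
    by apply/KP; split=> [|x _|x _ _]; rewrite ?group1 // perm1 ?mulVg.
  apply/KP; split=> [|x Qx|x Qx Ax]; first exact: groupM; rewrite permM.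
    rewrite -(mulKVg (s x) (t _)) mulgA groupM ?s1 ?t1 ?GQ //.
  by rewrite s2 ?t2.
have pK : p.-group (group gK).
  apply/pgroupP=> q pr_q /(Cauchy pr_q)[s /KP[Gs s1 s2] ordS].
  (* The factor [x^-1 * s x] lies in the intersection of [Q] and [A], where [s] is trivial, so it
     accumulates as a power; hence [s ^+ #|A| = 1]. *)
  have Eexp n : {in Q, forall x, (s ^+ n) x = x * (x^-1 * s x) ^+ n}.
    elim: n => [|n IHn] x Qx; first by rewrite perm1 mulg1.
    have QAa : x^-1 * s x \in Q by rewrite groupM ?groupV ?GQ.
    have Qa : (x^-1 * s x) ^+ n \in Q by rewrite groupX.
    rewrite expgSr permM IHn // GM // [s (_ ^+ n)]s2 ?groupX ?s1 //.
    by rewrite expgS mulgA mulKVg.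
  have: s ^+ #|A| = 1.
    have AsQ : s \in Aut Q by case/autFP: Gs.
    apply: (eq_Aut (groupX _ AsQ) (group1 _)) => x Qx.
    by rewrite Eexp // expg_cardG ?s1 // mulg1 perm1.
  move/eqP; rewrite -order_dvdn ordS => q_A.
  exact: (pgroupP (pgroupS sAS pS)) q pr_q q_A.
have nKG : group gK <| G.
  apply/andP; split; first by apply/subsetP=> s /KP[].
  apply/subsetP=> t Gt; rewrite inE; apply/subsetP=> _ /imsetP[s /KP[Gs s1 s2] ->].
  have Gt1 : t^-1 \in G by rewrite groupV.
  apply/KP; split=> [|x Qx|x Qx Ax]; first by rewrite groupJ.
    have Qy := GQ _ _ Gt1 Qx; set y := t^-1 x in Qy.
    have -> : x = t y by rewrite permKV.
    have Qs : y^-1 * s y \in Q by rewrite groupM ?groupV ?GQ.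
    by rewrite permJ -GV // -GM ?groupV ?GQ // GA ?s1.
  have Qy := GQ _ _ Gt1 Qx; have := GA _ _ Gt1 Qx.
  set y := t^-1 x in Qy *; have -> : x = t y by rewrite permKV.
  by move=> Ay; rewrite permJ s2 // Ay permKV.
have sKS : K \subset autU S Q.
  apply: subset_trans (pcore_sub_Hall (sylQ : p.-Sylow(G) _)).
  exact: (pcore_max pK nKG).
have [f1 [f1Q fK f1K]] := fiso_inv fQ.
have [Ff Ff1] := (fiso_hom fQ, fiso_hom f1Q).
apply/subsetP=> g /setIP[Ag nQg]; have Sg := subsetP sAS g Ag.
have [Sg1 Ag1] : g^-1 \in S /\ g^-1 \in A by rewrite !groupV.
have nQg1 : g^-1 \in 'N(Q) by rewrite groupV.
have cQ : [ffun x => x ^ g^-1] \in fiso F Q Q.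
  have sQg1 : Q :^ g^-1 \subset Q by rewrite (normP nQg1).
  apply: im_fiso (fus_conjg sQS sQS Sg1 sQg1) _.
  by rewrite -[RHS](normP nQg1); apply: eq_imset => x; rewrite ffunE.
have [s Gs sE] := fiso_autF (fiso_comp f1Q (fiso_comp cQ fQ)).
(* Here [s] displaces [y] by the image under [f] of a commutator with [g^-1]. This commutator is in
   [A] because [A] is normal in [S], and [f] preserves membership in [A]. As [A] is abelian, [s]
   fixes the elements of [Q] in [A]. *)
have Ks : s \in K.
  apply/KP; split=> // y Qy => [|Ay]; rewrite sE // !ffunE.
    have Qx := mem_fus Ff1 Qy; set x := f1 y in Qx *.
    have Qxg : x ^ g^-1 \in Q by rewrite memJ_norm.
    have Qm : x^-1 * x ^ g^-1 \in Q by rewrite groupM ?groupV.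
    have -> : y^-1 = f x^-1 by rewrite (fusV Ff) // f1K.
    rewrite -(fusM Ff) ?groupV // (scQ _ _ _ _ Ff) //.
    rewrite -commgEl commgEr groupM // memJ_norm ?groupV //.
    by rewrite (subsetP nAS) // (subsetP sQS).
  have Ax : f1 y \in A by rewrite (scQ _ _ _ _ Ff1).
  by rewrite conjgE invgK mulgA (centsP cAA _ Ag) // mulgK f1K.
have /morphimP[k nQk Sk sk] := subsetP sKS s Ks.
apply: (@mem_Nphi _ _ _ g k); rewrite ?in_setI ?Sg ?Sk //.
move=> x Qx; have Qfx := mem_fus Ff Qx.
by rewrite -(norm_conj_autE nQk Qfx) -sk sE // !ffunE fK.
Qed.

(** Induction on the index-like quantity [#|S| - #|P|]. With [Q] a fully normalized conjugate of [P]
    and [R] the image of [f], morphisms [u] on [P <*> A] and [v] on [R <*> A] send [P] and [R] onto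
    [Q]. They turn [f] into an automorphism [a] of [Q]; once [a] is extended to [b] on [Q <*> A],
    the extension of [f] is [u], then [b], then the inverse of [v]. *)
Lemma strongly_closed_ext P f :
  f \in F P S -> exists2 g, g \in F (P <*> A)%G S & {in P, g =1 f}.
Proof.
have /andP[_ nAS] := weakly_closed_normal wcA.
have [n] := ubnP (#|S| - #|P|); elim: n => // n IHn in P f * => lePn Ff.
have sPS := fus_src Ff; rewrite ltnS in lePn.
have joinE Q : A \subset Q -> (Q <*> A)%G = Q.
  by move=> sAQ; apply: val_inj; apply/joing_idPl.
have IH Q h : #|P| < #|Q| -> h \in F Q S ->
    exists2 g, g \in F (Q <*> A)%G S & {in Q, g =1 h}.
  move=> ltPQ Fh; apply: IHn (Fh); apply: leq_trans lePn.
  by rewrite ltn_sub2l // (leq_trans ltPQ) ?subset_leq_card ?(fus_src Fh).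
have [Q PQ fnQ] := ex_fully_normalized sPS; have [_ sQS] := fclass_sub PQ.
(* When [A] is not inside [R], [R] is proper in [S] and so in [N_S(R)]; induction then applies to
   the morphism on [N_S(R)]. *)
have toQ R : #|R| = #|P| -> Q \in fclass F R ->
    exists2 g, g \in F (R <*> A)%G S & g @: R = Q.
  move=> oR RQ; have [sRS _] := fclass_sub RQ.
  have [g Fg gR] := fully_normalized_ext fnQ RQ.
  have sRN : R \subset 'N_S(R) by rewrite subsetI sRS normG.
  have [sAR | not_sAR] := boolP (A \subset R).
    by exists g; rewrite // joinE //; apply: fus_res Fg sRN.
  have ltRS : R \proper S.
    by rewrite properE sRS; apply: contra not_sAR; apply: subset_trans.
  have ltRN := nilpotent_proper_norm (pgroup_nil pS) ltRS.
  have [|h Fh hE] := IH _ _ _ Fg; first by rewrite -oR proper_card.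
  exists h; first by apply: fus_res Fh _; rewrite genS ?setSU.
  by rewrite -gR; apply: eq_in_imset => x /(subsetP sRN)/hE.
have [R PR fP] := fclass_fus Ff.
have [u Fu uP] := toQ P (erefl _) PQ.
have [v Fv vR] := toQ R (fclass_card PR) (fclass_trans (fclass_sym PR) PQ).
have uPA := im_fiso (R := (Q <*> A)%G) Fu (weakly_closed_im_join wcA Fu uP).
have vRA := im_fiso (R := (Q <*> A)%G) Fv (weakly_closed_im_join wcA Fv vR).
have [w [wQA vK wK]] := fiso_inv vRA.
have uQ := im_fiso (fus_res Fu (joing_subl P A)) uP.
have vQ := im_fiso (fus_res Fv (joing_subl R A)) vR.
have [u1 [u1P uK _]] := fiso_inv uQ.
have fR := im_fiso Ff fP.
have aQ := fiso_comp u1P (fiso_comp fR vQ); set a := [ffun x => _] in aQ.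
have [b Fb bE] : exists2 b, b \in F (Q <*> A)%G S & {in Q, b =1 a}.
  have Fa := fus_widen (fiso_hom aQ) sQS (subxx S).
  have [sAQ | not_sAQ] := boolP (A \subset Q); first by exists a; rewrite ?joinE.
  have [_ satF2] := satF; have [fcQ _] := satF.1 Q fnQ.
  have [h Fh /eq_onP hE] := satF2 Q Q a aQ fcQ.
  have sNh := subset_trans (norm_sub_Nphi fnQ aQ) (subset_gen _).
  have sQh : Q \subset <<Nphi S Q Q a>>.
    apply: sub_gen; apply/subsetP=> x Qx; have Fa1 := fiso_hom aQ.
    have Qax := mem_fus Fa1 Qx.
    have sQN : Q \subset 'N_S(Q) by rewrite subsetI sQS normG.
    apply: (@mem_Nphi _ _ _ x (a x)^-1); rewrite ?groupV ?(subsetP sQN) //.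
    by move=> y Qy; rewrite (fus_conj Fa1) ?(fusV Fa1) ?groupV.
  (* By the Dedekind law the normalizer of [Q] in [Q <*> A] is [Q * 'N_A(Q)]. It is strictly larger
     than [Q] by nilpotency, and both factors lie in the group generated by [Nphi]. *)
  have ltQ : Q \proper <<Nphi S Q Q a>>.
    have ltQA : Q \proper Q <*> A.
      by rewrite properE joing_subl join_subG subxx.
    have sQAS : Q <*> A \subset S by rewrite join_subG sQS.
    have := nilpotent_proper_norm (nilpotentS sQAS (pgroup_nil pS)) ltQA.
    move/proper_sub_trans; apply.
    rewrite /= norm_joinEl ?(subset_trans sQS) // -group_modl ?normG //.
    by rewrite mul_subG.
  have [|g Fg gE] := IH _ _ _ Fh; first by rewrite -(fclass_card PQ) proper_card.
  exists g; first by apply: fus_res Fg _; rewrite genS ?setSU.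
  by move=> x Qx; rewrite gE ?hE // (subsetP sQh).
have bQ : b @: Q = Q by rewrite -[RHS](fiso_im aQ); apply: eq_in_imset.
have bQA := im_fiso (R := (Q <*> A)%G) Fb (weakly_closed_im_join wcA Fb bQ).
have := fiso_comp uPA (fiso_comp bQA wQA); set g := [ffun x => _] => gRA.
have sRAS : R <*> A \subset S by rewrite (fus_src Fv).
exists g; first exact: fus_widen (fiso_hom gRA) sRAS (subxx S).
move=> x Px; have Rfx := mem_fus (fiso_hom fR) Px.
have Qux := mem_fus (fiso_hom uQ) Px.
by rewrite !ffunE bE // !ffunE uK // vK // mem_gen // inE Rfx.
Qed.

Lemma strongly_closed_fnormal : fnormal F A.
Proof.
move=> Q R f Ff; have [sQS sRS] := fusion_obj fusF Ff.
have [g Fg gE] := strongly_closed_ext (fus_widen Ff sRS (subxx S)).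
have gA := weakly_closed_im wcA Fg (joing_subr Q A).
exists g; split=> //; last exact/eq_onP.
apply: (fus_corestrict Fg); last by rewrite join_subG sRS.
have [Q1 _ fQ1] := fclass_fus Ff.
have gQ1 : g @: Q = Q1 by rewrite -fQ1; apply: eq_in_imset.
rewrite (weakly_closed_im_join wcA Fg gQ1) genS // setSU // -fQ1.
exact: fus_im Ff.
Qed.

End StronglyClosed.

(** * Self-centralising abelian subgroups *)

Section Centric.

Implicit Types U V W Z As B : {group gT}.

Hypothesis CSA : 'C_S(A) = A.

Lemma cent_memA x : x \in S -> (x \in 'C(A)) = (x \in A).
Proof. by move=> Sx; rewrite -[in RHS]CSA inE Sx. Qed.

Lemma fus_im_gen P B (X : {set gT}) f :
  f \in F P S -> X \subset P -> {in X, forall x, f x \in B} ->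
  {in <<X>>, forall x, f x \in B}.
Proof.
move=> Ff sXP fX; pose m := Morphism (fusM Ff).
have : <<X>> \subset m @*^-1 B.
  by rewrite gen_subG; apply/subsetP=> x Xx; rewrite inE (subsetP sXP) // inE fX.
by move/subsetP=> sX x /sX/morphpreP[].
Qed.

Lemma fus_im_joing P B (X Y : {set gT}) f :
  f \in F P S -> X \subset P -> Y \subset P -> {in X, forall x, f x \in B} ->
  {in Y, forall y, f y \in B} -> {in X <*> Y, forall z, f z \in B}.
Proof.
move=> Ff sXP sYP fX fY; apply: (fus_im_gen Ff); first by rewrite subUset sXP.
by move=> z /setUP[/fX | /fY].
Qed.

Lemma fus_im_cycle P B f (x : gT) :
  f \in F P S -> x \in P -> f x \in B -> {in <[x]>, forall y, f y \in B}.
Proof.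
move=> Ff Px Bfx; apply: (fus_im_gen Ff); first by rewrite sub1set.
by move=> _ /set1P->.
Qed.

Lemma card_autU_centric U : U \subset S -> U \subset 'N(A) ->
  #|autU U A| = #|U : U :&: A|.
Proof.
move=> sUS nAU; rewrite card_autU //; congr #|_ : _|.
by rewrite -[X in _ = _ :&: X]CSA setIA (setIidPl sUS).
Qed.

(** Since [A] is its own centralizer in [S], [Aut_U(A)] has order [|U : U :&: A| = |UA / A|], which
    [scrW] equates with the required fixed-point count. [U] is abelian, being isomorphic to a
    subgroup of [A], and therefore centralizes [As]. *)
Lemma Rhat_scrW t U As : (t, U, As) \in scrW S F A -> U :&: A = As ->
  (caut A t, autU U A, As) \in Rhat (autU S A) A.
Proof.
rewrite inE => /and5P[Tt UU cAst _ /eqP cardU] UAs.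
have /setIdP[/setDP[/setIP[St nAt] A't] /set0Pn[_ /setIP[/imsetP[f Ff ->] Aft]]] := Tt.
have := UU; rewrite inE => /and4P[_ sUN _ /set0Pn[g Fg]].
have [[sUS nAU] sAsA] : (U \subset S /\ U \subset 'N(A)) /\ As \subset A.
  by split; [apply/andP; rewrite -subsetI | rewrite -UAs subsetIr].
have [V UV gU] := fclass_fus Fg.
have sVA : V \subset A by rewrite -gU (fus_im Fg).
have isoUV := fclass_isog UV.
have cUU : abelian U by rewrite (isog_abelian isoUV) (abelianS sVA).
apply: mem_Rhat => //.
- by rewrite -UAs (sub_abelian_cent2 cUU) ?subsetIl.
- rewrite !inE caut_eq1 // cent_memA // A't mem_morphim ?groupV //.
- exact: morphimS.
- have [W tW fW] := fclass_fus Ff.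
  apply: embeds_in_isog (fclass_isog tW); rewrite -fW.
  apply/subsetP=> _ /imsetP[y ty ->].
  exact: fus_im_cycle Ff (cycle_id t) Aft y ty.
- exact: embeds_in_isog isoUV.
rewrite card_autU_centric // -cardU quotientYidr //.
by rewrite indexgI /quotient card_morphim ker_coset (setIidPr nAU).
Qed.

(** If [A] is not normal in [S], an S-conjugate works. Otherwise [A] is fully normalized; for a
    conjugate [U] not normal in [S], an S-conjugate [V] of [U] and a morphism [g] on [N_S(U)] with
    [g(U) = A] give [W = g(V)], distinct from [A] by injectivity. *)
Lemma conj_mutually_normal : ~ weakly_closed F A ->
  exists U, [/\ U \in fclass F A :\ A, U \subset 'N_S(A) & A \subset 'N(U)].
Proof.
(* Take [g] normalizing [N_S(B)] but not [B]: then [B] and [B :^ g] both lie in [N_S(B)], which is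
   also contained in the normalizer of [B :^ g]. *)
have conjU B : B \subset S -> ~~ (S \subset 'N(B)) ->
    exists U, [/\ U \in fclass F B :\ B, U \subset 'N_S(B) & B \subset 'N_S(U)].
  move=> sBS not_nBS.
  have ltN : 'N_S(B) \proper S by rewrite properE subsetIl subsetI subxx.
  have := nilpotent_proper_norm (pgroup_nil pS) ltN.
  rewrite properE subsetI subsetIl normG /= => /subsetPn[g].
  case/setIP=> Sg nNg; rewrite inE Sg /= => not_nBg.
  have sBN : B \subset 'N_S(B) by rewrite subsetI sBS normG.
  have sBgS : B :^ g \subset S by rewrite conj_subG.
  have Fg := fus_conjg sBS sBgS Sg (subxx _).
  exists (B :^ g)%G; split.
  - rewrite !inE; apply/andP; split.
      apply: contra not_nBg => /eqP/(congr1 val) /= Bg; rewrite inE.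
      by rewrite Bg.
    apply/set0Pn; exists [ffun x => x ^ g]; apply: im_fiso Fg _.
    by apply: eq_imset => x; rewrite ffunE.
  - by rewrite -(normP nNg) conjSg.
  rewrite subsetI sBS /= normJ -sub_conjgV (subset_trans _ (subsetIr S _)) //.
  by rewrite -(normP (groupVr nNg)) conjSg.
move=> not_wcA; have [nAS | not_nAS] := boolP (S \subset 'N(A)); last first.
  have [U [UA sUN]] := conjU A sAS not_nAS.
  by rewrite subsetI => /andP[_ nUA]; exists U.
have [U UA] : exists U, U \in fclass F A :\ A.
  apply/existsP; apply: contra_notT not_wcA => /existsPn no_U.
  apply/setP=> U; rewrite !inE; have := no_U U; rewrite !inE.
  have [-> _ | _ /negbTE] //= := eqVneq U A.
  by have := fclass_refl sAS; rewrite inE.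
have NSA : 'N_S(A) = S by apply/setIidPl.
have /setD1P[neqUA AU] := UA; have [_ sUS] := fclass_sub AU.
have [nUS | not_nUS] := boolP (S \subset 'N(U)).
  by exists U; rewrite NSA (subset_trans sAS).
have [V [/setD1P[neqVU UV] sVNU sUNV]] := conjU U sUS not_nUS.
have fnA : fully_normalized S F A by rewrite normal_fully_normalized // /normal sAS.
have [g Fg gU] := fully_normalized_ext fnA (fclass_sym AU).
have [W VW gV] := fclass_fus (fus_res Fg sVNU).
have sWS : W \subset S by case: (fclass_sub VW).
have sUN : U \subset 'N_S(U) by rewrite subsetI sUS normG.
exists W; split; [ | by rewrite NSA | ]; last first.
- rewrite -gU; apply/subsetP=> _ /imsetP[u Uu ->].
  have /setIP[_ nVu] := subsetP sUNV u Uu.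
  rewrite inE -gV; apply/subsetP=> _ /imsetP[_ /imsetP[x Vx ->] ->].
  rewrite -(fus_conj Fg) ?(subsetP sVNU x) ?(subsetP sUN u) //.
  by rewrite imset_f // memJ_norm.
rewrite !inE; have := fclass_trans (fclass_trans AU UV) VW; rewrite inE => ->.
rewrite andbT; apply: contraNneq neqVU => WA; apply/eqP/val_inj/setP=> x /=.
have E B y : B \subset 'N_S(U) -> y \in 'N_S(U) -> (g y \in g @: B) = (y \in B).
  move=> sBN Ny; apply/imsetP/idP => [[z Bz /(fus_inj Fg)->] | By] //.
    exact: subsetP Bz.
  by exists y.
have [Nx | N'x] := boolP (x \in 'N_S(U)).
  by rewrite -(E V) // -(E U) // gV gU WA.
by rewrite (contraNF (subsetP sVNU x)) // (contraNF (subsetP sUN x)).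
Qed.

(** The orders match because [U] and [A] are isomorphic, so [|U : A :&: U| = |A : A :&: U|]. The
    same [U] serves every [t], so the family indexed by [U :\: A] is closed. *)
Lemma not_weakly_closed_scrR : ~ weakly_closed F A ->
  exists U, [/\ U \in fclass F A :\ A, U \subset 'N_S(A)
    & forall t, t \in U :\: A ->
        (caut A t, autU U A, (A :&: U)%G) \in scrR (autU S A) A].
Proof.
case/conj_mutually_normal=> U [UA sUN nUA]; exists U; split=> //.
have /setD1P[_ AU] := UA; have [sUS nAU] := subsetIP sUN.
have isoAU := fclass_isog AU.
have cUU : abelian U by rewrite -(isog_abelian isoAU).
have UAE : U :\: 'C(A) = U :\: A.
  apply/setP=> x; rewrite !inE andbC [RHS]andbC; apply: andb_id2l => Ux.
  by rewrite cent_memA // (subsetP sUS).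
have Rt t : t \in U :\: A ->
    (caut A t, autU U A, (A :&: U)%G) \in Rhat (autU S A) A.
  case/setDP=> Ut A't; have St := subsetP sUS t Ut; have nAt := subsetP nAU t Ut.
  have emb_U : embeds_in U A by apply: embeds_in_isog (subxx A) _; rewrite isog_sym.
  apply: mem_Rhat => //.
  - rewrite subsetI subsetIl sub_cent1 (subsetP _ t Ut) //.
    by rewrite (sub_abelian_cent2 cUU) ?subsetIr.
  - by rewrite (sub_abelian_cent2 cUU) ?subsetIr.
  - by rewrite !inE caut_eq1 // cent_memA // A't mem_morphim ?groupV.
  - exact: morphimS.
  - case/exists_inP: emb_U => V sVA isoUV.
    have [|W sWV isoW] := @isog_subgroup _ _ _ <[t]>%G _ isoUV.
      by rewrite cycle_subG.
    exact: embeds_in_isog (subset_trans sWV sVA) isoW.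
  have nIA : A \subset 'N(A :&: U) by rewrite normsI ?normG.
  have nIt : t \in 'N(A :&: U).
    by rewrite (subsetP _ t Ut) // normsI ?normG.
  rewrite card_autU_centric // [in LHS]setIC.
  have -> : 'C_(A / (A :&: U))[coset (A :&: U)%G t] = A / (A :&: U).
    apply/setIidPl; rewrite -cent_cycle -quotient_cycle // quotient_cents2r //.
    rewrite subsetI; apply/andP; split.
      by rewrite commg_subl cycle_subG.
    by apply: subset_trans (commgS A _) (_ : [~: A, U] \subset U);
      rewrite ?cycle_subG ?commg_subr.
  rewrite card_quotient // -!divgS ?subsetIl ?subsetIr //=.
  by rewrite (card_isog isoAU).
move=> t Ut; apply: (mem_scrR_family (E := U :\: A)); rewrite ?UAE ?Rt //.
by move=> u /Rt Rw; exists U, (A :&: U)%G; rewrite UAE.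
Qed.

Lemma fix_im_cent P Z f : f \in F P S -> Z \subset P -> P \subset 'C(Z) ->
  {in Z, f =1 id} -> f @: P \subset 'C_S(Z).
Proof.
move=> Ff sZP cZP fZ; apply/subsetP=> _ /imsetP[x Px ->].
rewrite inE (mem_fus Ff) //=; apply/centP=> z Zz.
have E : f z = z := fZ z Zz; have Pz := subsetP sZP z Zz.
have cxz := centP (subsetP cZP x Px) z Zz.
by rewrite /commute -{1}E -(fusM Ff) // cxz (fusM Ff) // E.
Qed.

(** * Weakly closed subgroups and centralizer systems *)

Section WeaklyClosedCentric.

Hypothesis wcA : weakly_closed F A.

(** The extension to [C_S(P)] is defined on [A], as [A] is abelian, and weak closure makes it
    preserve [A]. *)
Lemma weakly_closed_fc_ext P Q f :
  P \subset A -> fully_centralized S F Q -> f \in fiso F P Q ->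
  Q \subset A /\ exists g, [/\ g \in F 'C_S(P)%G S, {in P, g =1 f} & g @: A = A].
Proof.
move=> sPA fcQ fQ; have cPP := abelianS sPA cAA.
have [g Fg gE] := fully_centralized_ext cPP fcQ fQ.
have sAC : A \subset 'C_S(P) by rewrite subsetI sAS (sub_abelian_cent2 cAA).
have gA := weakly_closed_im wcA Fg sAC.
split; last by exists g.
rewrite -(fiso_im fQ) -gA; apply/subsetP=> _ /imsetP[x Px ->].
by rewrite -gE // imset_f // (subsetP sPA).
Qed.

Section Central.

Variable Z : {group gT}.
Hypotheses (sZA : Z \subset A) (fcZ : fully_centralized S F Z).

Let sAC : A \subset 'C_S(Z).
Proof. by rewrite subsetI sAS (sub_abelian_cent2 cAA). Qed.

(** Allows membership for the centralizer system to be tested with morphisms of [F] fixing [Z]: the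
    restriction to [<[t]> <*> Z] takes values in [C_S(Z)]. *)
Lemma mem_scrT_fcent t f P : t \in 'C_S(Z) -> t \notin A -> f \in F P S ->
  t \in P -> Z \subset P -> {in Z, f =1 id} -> f t \in A ->
  t \in scrT 'C_S(Z)%G (fcent S F Z) A.
Proof.
move=> Ct A't Ff Pt sZP fZ Aft; have /setIP[St cZt] := Ct.
have nAt : t \in 'N(A).
  by have /andP[_ nAS] := weakly_closed_normal wcA; apply: (subsetP nAS).
have sTC : <[t]> \subset 'C_S(Z) by rewrite cycle_subG.
have sTZP : <[t]> <*> Z \subset P by rewrite join_subG cycle_subG Pt.
have sCZS : 'C_S(Z) <*> Z \subset S.
  by rewrite join_subG subsetIl (subset_trans sZA).
have Ff1 : f \in F (<[t]> <*> Z)%G S := fus_res Ff sTZP.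
have imf : f @: (<[t]> <*> Z) \subset 'C_S(Z).
  apply: fix_im_cent (fZ) => //; first exact: joing_subr.
  rewrite join_subG cycle_subG cZt (sub_abelian_cent2 cAA) //.
apply/setIdP; split; first by rewrite in_setD A't in_setI [_ \in 'C_S(_)]Ct.
apply/set0Pn; exists (f t); rewrite inE Aft andbT; apply: imset_f.
rewrite inE sTC subxx /=; apply/exists_inP; exists f.
  by apply: fus_corestrict Ff1 _ sCZS; apply: subset_trans imf (joing_subl _ _).
apply/and3P; split; first by apply/eq_onP.
  by apply: subset_trans imf; apply: imsetS; apply: joing_subl.
by apply/forall_inP=> z Zz; rewrite fZ.
Qed.

Lemma scrT_fcentP t : t \in scrT 'C_S(Z)%G (fcent S F Z) A ->
  [/\ t \in 'C_S(Z), t \notin A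
    & exists f, [/\ f \in F (<[t]> <*> Z)%G S, {in Z, f =1 id} & f t \in A]].
Proof.
case/setIdP=> /setDP[/setIP[Ct _] A't] /set0Pn[_ /setIP[/imsetP[f Ff ->] Aft]].
split=> //; move: Ff; rewrite inE => /and3P[_ _ /exists_inP[g Fg]].
case/and3P=> /eq_onP fE _ /forall_inP gZ.
exists g; split; first exact: fus_widen Fg (fus_tgt Fg) (subxx S).
  by move=> z /gZ/eqP.
by rewrite -fE ?cycle_id.
Qed.

(** Normality would extend a morphism taking [t] into [A] to one on [<[t]> <*> A] that maps [A] onto
    itself; injectivity would then put [t] in [A]. *)
Lemma scrT_not_fnormal :
  scrT 'C_S(Z)%G (fcent S F Z) A != set0 -> ~ fnormal (fcent S F Z) A.
Proof.
case/set0Pn=> t /scrT_fcentP[Ct A't [f [Ff fZ Aft]]] nA.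
have Ff1 : f \in fcent S F Z <[t]>%G A.
  have fimA : {in <[t]> <*> Z, forall x, f x \in A}.
    apply: (fus_im_joing Ff); rewrite ?joing_subl ?joing_subr //.
      by apply: (fus_im_cycle Ff) => //; rewrite mem_gen // inE cycle_id.
    by move=> z Zz; rewrite fZ // (subsetP sZA).
  rewrite inE cycle_subG Ct sAC; apply/exists_inP; exists f.
    apply: fus_corestrict Ff _ _; last by rewrite join_subG sAS (subset_trans sZA).
    apply/subsetP=> _ /imsetP[x TZx ->]; apply: mem_gen; apply/setUP; left.
    by apply: fimA.
  apply/and3P; split; first exact/eq_onP.
    apply/subsetP=> _ /imsetP[x Tx ->]; apply: fimA.
    exact: (subsetP (joing_subl _ _)).
  by apply/forall_inP=> z Zz; rewrite fZ.
have [g [Fg /eq_onP gf gA]] := nA _ _ _ Ff1.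
have : g t \in g @: A by rewrite gA gf ?cycle_id.
case/imsetP=> a Aa gta; case/negP: A't.
move: Fg; rewrite inE => /and3P[_ _ /exists_inP[h Fh /andP[/eq_onP gh _]]].
have sub := subsetP (joing_subl (<[t]> <*> A) Z).
have [Tt Ta] : t \in <[t]> <*> A /\ a \in <[t]> <*> A.
  by rewrite !mem_gen // inE ?cycle_id ?Aa ?orbT.
suff -> : t = a by [].
by apply: (fus_inj Fh); rewrite ?sub // -!gh.
Qed.

End Central.

(** * Triples over a central subgroup of maximal order *)

Section MaximalCentral.

Variable Z : {group gT}.
Hypotheses (sZA : Z \subset A) (fcZ : fully_centralized S F Z).
Hypothesis maxZ : forall Q, Q \subset A -> fully_centralized S F Q ->
     scrT 'C_S(Q)%G (fcent S F Q) A != set0 -> #|Q| <= #|Z|.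

(* If phi moved a into A with a outside Z, then A would fail to be strongly
   closed also in the centralizer of a fully centralized conjugate of Z<a>. *)
Lemma maximal_central_preim P t f a :
  f \in F P S -> t \in P -> Z \subset P -> {in Z, f =1 id} ->
  t \in 'C_S(Z) -> t \notin A -> f t \in A -> a \in P -> a \in A ->
  a \in 'C[t] -> f a \in A -> a \in Z.
Proof.
move=> Ff Pt sZP fZ /setIP[St cZt] A't Aft Pa Aa cat Afa.
apply: contraLR (leqnn #|Z|) => Z'a; rewrite -ltnNge.
pose W := (<[a]> <*> Z)%G.
have sWA : W \subset A by rewrite join_subG cycle_subG Aa.
have sWP : W \subset P by rewrite join_subG cycle_subG Pa.
have ltZW : #|Z| < #|W|.
  apply: proper_card; rewrite properE joing_subr.
  by rewrite join_subG cycle_subG (negPf Z'a).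
have sWS := subset_trans sWA sAS.
have [Q WQ fcQ] := ex_fully_centralized sWS.
have [h hQ] : exists h, h \in fiso F W Q by apply/set0Pn; rewrite inE in WQ.
have [sQA [g [Fg gE gA]]] := weakly_closed_fc_ext sWA fcQ hQ.
have gW : g @: W = Q by rewrite -(fiso_im hQ); apply: eq_in_imset.
have cWt : t \in 'C(W).
  rewrite -sub_cent1 join_subG cycle_subG sub_cent1 cZt andbT.
  exact: cat.
have CWt : t \in 'C_S(W) by rewrite inE St.
have sWC : W \subset 'C_S(W) by rewrite subsetI sWS (sub_abelian_cent2 cAA).
have sAC_W : A \subset 'C_S(W) by rewrite subsetI sAS (sub_abelian_cent2 cAA).
pose X := (<[t]> <*> W)%G.
have sXC : X \subset 'C_S(W) by rewrite join_subG cycle_subG CWt.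
have sXP : X \subset P by rewrite join_subG cycle_subG Pt.
have [Xt sWX] : t \in X /\ W \subset X.
  by rewrite joing_subr mem_gen // inE cycle_id.
have [R XR gX] := fclass_fus (fus_res Fg sXC).
have [k [kX gK kK]] := fiso_inv (im_fiso (fus_res Fg sXC) gX).
have [V WV fW] := fclass_fus (fus_res Ff sWP).
have [i [iW fK _]] := fiso_inv (im_fiso (fus_res Ff sWP) fW).
have fA : {in X, forall x, f x \in A}.
  apply: (fus_im_joing Ff); rewrite ?cycle_subG //.
    by apply: (fus_im_cycle Ff).
  apply: (fus_im_joing Ff); rewrite ?cycle_subG //.
    by apply: (fus_im_cycle Ff).
  by move=> z Zz; rewrite fZ // (subsetP sZA).
have sVA : V \subset A.
  by rewrite -fW; apply/subsetP=> _ /imsetP[x Wx ->]; rewrite fA ?(subsetP sWX).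
have [_ [d [Fd dE dA]]] := weakly_closed_fc_ext sVA fcQ (fiso_comp iW hQ).
have sAC_V : A \subset 'C_S(V) by rewrite subsetI sAS (sub_abelian_cent2 cAA).
have FfX : f \in F X A.
  apply: (fus_corestrict (fus_res Ff sXP)) => //.
  by apply/subsetP=> _ /imsetP[x Xx ->]; apply: fA.
(* The composite undoes [g], applies [f], then applies [d], which returns [f(W)] to [Q]. It fixes
   [Q] pointwise and sends [g t] into [A], while [g t] is outside [A] because [g] preserves [A]. *)
have Fe := fus_comp (fiso_hom kX) (fus_comp FfX (fus_res Fd sAC_V)).
set e := [ffun x => _] in Fe.
have eE x : x \in X -> e (g x) = d (f x) by move=> Xx; rewrite !ffunE gK.
have sQR : Q \subset R by rewrite -gW -gX imsetS.
have eQ : {in Q, e =1 id}.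
  move=> y; rewrite -gW => /imsetP[x Wx ->].
  have Vfx : f x \in V by rewrite -fW imset_f.
  by rewrite eE ?(subsetP sWX) // dE // ffunE fK // gE.
have Rgt : g t \in R by rewrite -gX imset_f.
apply: leq_trans ltZW _; rewrite -(fclass_card WQ); apply: maxZ => //.
apply/set0Pn; exists (g t).
have gWt x : x \in W -> g t * g x = g x * g t.
  move=> Wx; have Cx := subsetP sWC x Wx.
  by rewrite -!(fusM Fg) // (centP cWt x Wx).
apply: (mem_scrT_fcent sQA _ _ Fe) => //; last first.
- by rewrite eE // -dA imset_f // fA.
- rewrite -gA; apply: contra A't => /imsetP[b Ab gtb].
  by suff -> : t = b by []; apply: (fus_inj Fg) gtb; rewrite ?(subsetP sAC_W b).
rewrite inE (mem_fus Fg) //=; apply/centP=> y; rewrite -gW => /imsetP[x Wx ->].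
exact: gWt.
Qed.

(** The commutator condition makes [D] normalize [P = <[t]> <*> Z]. A fully normalized conjugate [Q]
    of [P] lies in [A], and some [g] on [N_S(P)] sends [P] onto [Q]. Since [g] may move [Z], it is
    followed by a morphism [h] that brings the image of [Z] back and preserves [A]. *)
Lemma central_fus_ext (D : {group gT}) t : D \subset A -> Z \subset D ->
  (forall d, d \in D -> [~ d, t] \in Z) ->
  t \in scrT 'C_S(Z)%G (fcent S F Z) A ->
  exists f, [/\ f \in F (D <*> <[t]>)%G S, {in Z, f =1 id} & f t \in A].
Proof.
move=> sDA sZD comDt /scrT_fcentP[/setIP[St cZt] A't [f [Ff fZ Aft]]].
have sZS := subset_trans sZA sAS; have sDS := subset_trans sDA sAS.
pose P := (<[t]> <*> Z)%G; have sPS : P \subset S := fus_src Ff.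
have [Pt sZP] : t \in P /\ Z \subset P.
  by rewrite joing_subr mem_gen // inE cycle_id.
have [Q PQ fnQ] := ex_fully_normalized sPS.
have [V PV fP] := fclass_fus Ff.
have sVA : V \subset A.
  rewrite -fP; apply/subsetP=> _ /imsetP[x Px ->].
  apply: (fus_im_joing Ff) x Px; rewrite ?joing_subl ?joing_subr //.
    by apply: (fus_im_cycle Ff).
  by move=> z Zz; rewrite fZ // (subsetP sZA).
have [fcQ _] := satF.1 Q fnQ.
have [i iQ] : exists i, i \in fiso F V Q.
  by apply/set0Pn; have := fclass_trans (fclass_sym PV) PQ; rewrite inE.
have [sQA _] := weakly_closed_fc_ext sVA fcQ iQ.
have [g Fg gP] := fully_normalized_ext fnQ PQ.
pose N := (D <*> <[t]>)%G.
have sNN : N \subset 'N_S(P).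
  have nPt : t \in 'N_S(P) by rewrite in_setI St (subsetP (normG P)).
  rewrite join_subG cycle_subG nPt andbT subsetI sDS.
  apply/subsetP=> d Dd; rewrite inE conjYg join_subG -cycleJ cycle_subG.
  have -> : Z :^ d = Z.
    by apply/normP; apply: subsetP d Dd; rewrite cents_norm // (sub_abelian_cent2 cAA).
  rewrite joing_subr andbT conjg_mulR groupM // -invg_comm groupV.
  exact: (subsetP sZP) (comDt d Dd).
have cNZ : N \subset 'C(Z).
  by rewrite join_subG cycle_subG cZt (sub_abelian_cent2 cAA).
have [Nt sZN] : t \in N /\ Z \subset N.
  rewrite mem_gen ?inE ?cycle_id ?orbT //; split=> //.
  exact: subset_trans sZD (joing_subl _ _).
have FgN := fus_res Fg sNN.
have [Z1 ZZ1 gZ] := fclass_fus (fus_res FgN sZN).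
have sZ1A : Z1 \subset A by rewrite -gZ; apply: subset_trans sQA; rewrite -gP imsetS.
have gZi := im_fiso (fus_res FgN sZN) gZ.
have [k [kZ gK _]] := fiso_inv gZi.
have [_ [h [Fh hE hA]]] := weakly_closed_fc_ext sZ1A fcZ kZ.
have gNC : g @: N \subset 'C_S(Z1).
  apply/subsetP=> _ /imsetP[x Nx ->]; rewrite inE (mem_fus FgN) //=.
  apply/centP=> y; rewrite -gZ => /imsetP[z Zz ->]; have Nz := subsetP sZN z Zz.
  by rewrite /commute -!(fusM FgN) // (centP (subsetP cNZ x Nx) z Zz).
have FgC := fus_corestrict FgN gNC (subsetIl _ _).
exists [ffun x => h (g x)]; split; first exact: fus_comp FgC Fh.
  move=> z Zz; rewrite ffunE hE ?gK //.
  by rewrite -gZ imset_f.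
by rewrite ffunE -hA imset_f // (subsetP sQA) // -gP imset_f.
Qed.

(** Here [U = f(D)]. The inverse of [f] on [U] sends [U] into [A] and fixes [Z], so every element of
    [U :\: A] is again in [scrT] of the centralizer system; this is what makes the family of triples
    closed. *)
Lemma maximal_central_triple t : t \in scrT 'C_S(Z)%G (fcent S F Z) A ->
  exists U, [/\ U \in scrU 'C_S(Z)%G (fcent S F Z) A, U :&: A = Z,
    U \subset 'N(A), U :\: 'C(A) \subset scrT 'C_S(Z)%G (fcent S F Z) A
    & (caut A t, autU U A, Z) \in Rhat 'C_(autU S A)(Z | 'P)%G A].
Proof.
move=> Tt; have [Ct A't [f0 [Ff0 f0Z Af0t]]] := scrT_fcentP Tt.
have [/setIP[St cZt] /andP[_ nAS]] := (Ct, weakly_closed_normal wcA).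
have sZS := subset_trans sZA sAS; have nAt := subsetP nAS t St.
have cZA : A \subset 'C(Z) by rewrite (sub_abelian_cent2 cAA).
have nZt : t \in 'N(Z) by rewrite (subsetP (cent_sub Z)).
have nZA : A \subset 'N(Z) by rewrite cents_norm.
pose D := (coset Z @*^-1 'C_(A / Z)[coset Z t])%G.
have sZD : Z \subset D by apply: sub_cosetpre.
have sDA : D \subset A.
  by rewrite sub_cosetpre_quo ?subsetIl // /normal sZA.
have DZ : D / Z = 'C_(A / Z)[coset Z t] by rewrite cosetpreK.
have comDt d : d \in D -> [~ d, t] \in Z.
  move=> Dd; have nZd : d \in 'N(Z) by rewrite (subsetP nZA) // (subsetP sDA).
  have : coset Z d \in 'C_(A / Z)[coset Z t] by rewrite -DZ mem_quotient.
  case/setIP=> _ /cent1P cdt; rewrite coset_idr ?groupR //.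
  by rewrite morphR //; apply/eqP/commgP.
have [f [Ff fZ Aft]] := central_fus_ext sDA sZD comDt Tt.
set N := (D <*> <[t]>)%G in Ff.
have sDN : D \subset N := joing_subl _ _.
have Nt : t \in N by rewrite mem_gen // inE cycle_id orbT.
have sZN := subset_trans sZD sDN.
have [U DU fD] := fclass_fus (fus_res Ff sDN).
have fDi := im_fiso (fus_res Ff sDN) fD; have [k [kD fK kK]] := fiso_inv fDi.
have isoDU := fclass_isog DU.
have [_ sUS] := fclass_sub DU; have nAU := subset_trans sUS nAS.
have sZU : Z \subset U.
  by apply/subsetP=> z Zz; rewrite -[z](fZ z Zz) -fD imset_f // (subsetP sZD).
have kZ : {in Z, k =1 id}.
  by move=> z Zz; have := fK z (subsetP sZD z Zz); rewrite [f z](fZ z Zz).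
have cUU : abelian U by rewrite -(isog_abelian isoDU) (abelianS sDA).
have UAZ : U :&: A = Z.
  apply/eqP; rewrite eqEsubset subsetI sZU sZA !andbT.
  apply/subsetP=> u /setIP[]; rewrite -fD => /imsetP[d Dd ->] Afd.
  have [Nd Ad] := (subsetP sDN d Dd, subsetP sDA d Dd).
  suff Zd : d \in Z by rewrite [f d](fZ d Zd).
  (* If [f d] is in [A] it commutes with [f t], so [d] commutes with [t] by injectivity, and
     maximality of [Z] applies. *)
  apply: (maximal_central_preim Ff Nt sZN fZ) => //.
  apply/cent1P; apply: (fus_inj Ff); rewrite ?groupM // !(fusM Ff) //.
  exact: (centsP cAA).
have sUC : U \subset 'C_S(Z) by rewrite subsetI sUS (sub_abelian_cent2 cUU).
have UCA : U :\: 'C(A) = U :\: A.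
  apply/setP=> x; rewrite !inE andbC [RHS]andbC; apply: andb_id2l => Ux.
  by rewrite cent_memA // (subsetP sUS).
have Fk := fiso_hom kD; have FkS := fus_widen Fk (subset_trans sDA sAS) (subxx S).
have FkA := fus_widen Fk sDA sAS.
have cardDU : #|U| = #|D| by rewrite (card_isog isoDU).
have f_notZ x : x \in N -> f x \in Z -> x \in Z.
  move=> Nx Zfx; suff <- : f x = x by [].
  apply: (fus_inj Ff) => //; first exact: subsetP sZN _ Zfx.
  exact: fZ.
have ntAZ : A / Z != 1.
  rewrite -subG1 quotient_sub1 //; apply: contra A't => sAZ.
  by rewrite (subsetP sZA) // f_notZ // (subsetP sAZ).
(* The nontrivial normal subgroup [A / Z] of the nilpotent group ['C_S(Z) / Z] meets its center,
   which centralizes the coset of [t]. Hence [D] exceeds [Z], and [U] is not inside [A]. *)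
have ltZD : #|Z| < #|D|.
  have nACZ : A / Z <| 'C_S(Z) / Z.
    by rewrite quotient_normal // /normal subsetI sAS cZA subIset // nAS.
  have nilC : nilpotent ('C_S(Z) / Z).
    by rewrite quotient_nil // (nilpotentS (subsetIl _ _) (pgroup_nil pS)).
  have := meet_center_nil nilC nACZ ntAZ.
  rewrite ltnNge; apply: contra => leDZ; rewrite -subG1.
  have DZ1 : D :=: Z by apply/eqP; rewrite eq_sym eqEcard sZD.
  have -> : 1 = 'C_(A / Z)[coset Z t] by rewrite -DZ DZ1 trivg_quotient.
  apply: setIS; rewrite subIset // -cent_set1 centS ?orbT //.
  by rewrite sub1set mem_quotient.
have not_sUA : ~~ (U \subset A).
  apply/negP=> sUA; move: ltZD; rewrite -cardDU -UAZ (setIidPl sUA).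
  by rewrite ltnn.
exists U; split=> //.
- rewrite inE not_sUA subsetI sUC nAU /=; apply/andP; split.
    by apply: contraNneq not_sUA => ->; rewrite sub1G.
  apply/set0Pn; exists k; rewrite inE sUC subsetI sAS cZA /=.
  apply/exists_inP; exists k.
    have -> : (U <*> Z)%G = U by apply: val_inj; apply/joing_idPl.
    by have -> : (A <*> Z)%G = A by apply: val_inj; apply/joing_idPl.
  apply/and3P; split; [exact/eq_onP | exact: fus_im FkA |].
  by apply/forall_inP=> z Zz; rewrite kZ.
- rewrite UCA; apply/subsetP=> u /setDP[Uu A'u].
  apply: (mem_scrT_fcent sZA _ A'u FkS) => //; first exact: (subsetP sUC).
  exact: mem_fus FkA Uu.
have autC u : u \in 'C_S(Z) -> caut A u \in 'C_(autU S A)(Z | 'P).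
  case/setIP=> Su cZu; have nAu := subsetP nAS u Su.
  rewrite inE mem_morphim ?groupV //=; apply/astabP=> z Zz.
  rewrite /= apermE cautE ?(subsetP sZA) // conjgE invgK.
  by rewrite mulgA (centP cZu z Zz) mulgK.
have emb_U : embeds_in U A.
  by apply: embeds_in_isog sDA _; rewrite isog_sym.
apply: mem_Rhat => //.
- by rewrite subsetI sZA sub_cent1.
- by rewrite (sub_abelian_cent2 cUU).
- by rewrite in_setD1 caut_eq1 // cent_memA // A't autC.
- by apply/subsetP=> _ /(autUP nAU)[u Uu ->]; apply: autC; apply: (subsetP sUC).
- have sTN : <[t]> \subset N by rewrite cycle_subG.
  have [W tW fW] := fclass_fus (fus_res Ff sTN).
  apply: embeds_in_isog (fclass_isog tW); rewrite -fW.
  by apply/subsetP=> _ /imsetP[y ty ->]; apply: (fus_im_cycle Ff) ty.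
have nZD := subset_trans sDA nZA.
by rewrite card_autU_centric // UAZ -DZ card_quotient // -!divgS //= cardDU.
Qed.

End MaximalCentral.

Lemma scrT_not_strongly_closed : ~ fnormal F A -> scrT S F A != set0.
Proof.
by move=> not_nA; apply/eqP=> T0; apply: not_nA; apply: strongly_closed_fnormal.
Qed.

Lemma weakly_closed_scrR : ~ fnormal F A ->
  exists Z, [/\ Z \subset A, fully_centralized S F Z,
    scrT 'C_S(Z)%G (fcent S F Z) A != set0
  & forall t, t \in scrT 'C_S(Z)%G (fcent S F Z) A ->
    exists U, [/\ U \in scrU 'C_S(Z)%G (fcent S F Z) A, U :&: A = Z
      & (caut A t, autU U A, Z) \in scrR 'C_(autU S A)(Z | 'P)%G A]].
Proof.
move=> not_nA.
pose good Z := [&& Z \subset A, fully_centralized S F Z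
                 & scrT 'C_S(Z)%G (fcent S F Z) A != set0].
(* The trivial subgroup is a candidate, so one of maximal order exists: all morphisms fix 1, and
   [scrT S F A] is nonempty since [A] is not normal in [F]. *)
have good1 : good 1%G.
  rewrite /good sub1G /=; apply/andP; split.
    rewrite /fully_centralized sub1G; apply/forall_inP=> Q _.
    by rewrite cent1T setIT subset_leq_card ?subsetIl.
  have /set0Pn[t /setIdP[/setDP[/setIP[St _] A't]]] := scrT_not_strongly_closed not_nA.
  case/set0Pn=> _ /setIP[/imsetP[f Ff ->] Aft]; apply/set0Pn; exists t.
  apply: (mem_scrT_fcent (sub1G A) _ A't Ff); rewrite ?sub1G ?cycle_id //.
    by rewrite cent1T setIT.
  by move=> _ /set1P->; rewrite (fus1 Ff).
have [Z /and3P[sZA fcZ ntZ] maxZ] := arg_maxnP (fun Z : {group gT} => #|Z|) good1.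
have maxZ' Q : Q \subset A -> fully_centralized S F Q ->
    scrT 'C_S(Q)%G (fcent S F Q) A != set0 -> #|Q| <= #|Z|.
  by move=> sQA fcQ ntQ; apply: maxZ; apply/and3P.
have triple := maximal_central_triple sZA fcZ maxZ'.
exists Z; split=> // t /triple[U [UU UAZ nAU sUE Rw]]; exists U; split=> //.
apply: mem_scrR_family nAU sUE Rw => u /triple[V [_ _ nAV sVE RV]].
by exists V, Z.
Qed.

End WeaklyClosedCentric.

End Centric.

End Fusion.

Theorem proposition2p4 (gT : finGroupType) (p : nat) (S : {group gT})
    (F : homsets gT) (A : {group gT}) :
  prime p -> p.-group S -> fusion_system S F -> saturated p S F ->
  A \subset S -> abelian A -> 'C_S(A) = A -> ~ fnormal F A ->
  let T := autU S A in
  [/\ scrR T A != set0 /\ scrR_plus T A != set0,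
      forall (t : gT) (U As : {group gT}),
        (t, U, As) \in scrW S F A -> U :&: A = As ->
        (caut A t, autU U A, As) \in Rhat T A,
      ~ weakly_closed F A ->
      exists U : {group gT},
        [/\ U \in fclass F A :\ A, U \subset 'N_S(A)
          & forall t : gT, t \in U :\: A ->
              (caut A t, autU U A, (A :&: U)%G) \in scrR T A]
    & weakly_closed F A ->
      exists Z : {group gT},
        [/\ Z \subset A, fully_centralized S F Z, ~ fnormal (fcent S F Z) A
          & forall t : gT, t \in scrT 'C_S(Z)%G (fcent S F Z) A ->
            exists U : {group gT},
              [/\ U \in scrU 'C_S(Z)%G (fcent S F Z) A, U :&: A \subset Z,
                  (caut A t, autU U A, (U :&: A)%G)
                    \in scrR 'C_T(Z | 'P)%G A
                & scrR 'C_T(Z | 'P)%G A \subset scrR T A]]].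
Proof.
move=> _ pS fusF satF sAS cAA CSA not_nA T.
have caseB := not_weakly_closed_scrR fusF sAS cAA pS satF CSA.
have caseC wcA := weakly_closed_scrR fusF sAS cAA pS satF CSA wcA not_nA.
have sub Z : scrR 'C_T(Z | 'P)%G A \subset scrR T A by apply/scrR_sub/subsetIl.
have ntR : scrR T A != set0.
  have [wcA | not_wcA] := eqVneq (fclass F A) [set A].
    have [Z [_ _ /set0Pn[t Tt] /(_ t Tt)[U [_ _ Rw]]]] := caseC wcA.
    by apply/set0Pn; exists (caut A t, autU U A, Z); apply: subsetP (sub Z) _ Rw.
  have [U [/setD1P[neqUA AU] _ RU]] := caseB (elimN eqP not_wcA).
  (* [U] has the same order as [A] and differs from it. *)
  have /subsetPn[t Ut A't] : ~~ (U \subset A).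
    apply: contra neqUA => sUA.
    by rewrite -val_eqE eqEcard sUA (fclass_card fusF AU) /=.
  by apply/set0Pn; exists (caut A t, autU U A, (A :&: U)%G); rewrite RU ?inE ?A't.
split=> //.
- split=> //; have /set0Pn[w Rw] := ntR.
  by apply/set0Pn; exists w; apply: (subsetP (scrR_sub_plus _ _)).
- by move=> t U As; apply: Rhat_scrW.
case/caseC=> Z [sZA fcZ ntZ RZ]; exists Z; split=> //.
  exact: (scrT_not_fnormal fusF).
move=> t /RZ[U [UU UAZ Rw]]; exists U; split=> //; first by rewrite UAZ.
by have -> : (U :&: A)%G = Z by apply: val_inj.
Qed.
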